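(* Let $\mathbb K$ be an algebraically closed field (of arbitrary characteristic), and let $\widetilde f,\widetilde g$ be two polynomials in two variables over $\mathbb K$, with given finite supports. Let $\Delta_f,\Delta_g\subset\mathbb R^2$ be the Newton polygons of $\widetilde f$ and $\widetilde g$ respectively. If the coefficients of $\widetilde f$ and $\widetilde g$ are generic, then the number of common roots of the curves $\widetilde f=0$ and $\widetilde g=0$ in $(\mathbb K^* )^2$, counted with multiplicities, is the mixed volume of the Newton polygons $$\mathcal M(\Delta_f,\Delta_g)=vol(\Delta_f+\Delta_g)-vol(\Delta_f)-vol(\Delta_g).$$
   Context: The Newton polygon of a polynomial is the convex hull in $\mathbb R^2$ of its support (the set of exponent vectors of its monomials with nonzero coefficient). $\Delta_f+\Delta_g$ is the Minkowski sum and $vol$ is Euclidean area in $\mathbb R^2$ ($0$ for segments and points). ''The coefficients are generic'' means: for fixed supports of $\widetilde f$ and $\widetilde g$, the vector of all coefficients lies in a suitable nonempty Zariski open subset (depending only on the supports and $\mathbb K$) of the space of coefficients. Multiplicity of a common root is the intersection multiplicity of the two curves at it. *)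

(* Defs.v *)
(* mpoly is imported before the analysis files: the opposite order makes the
   notation levels of the two libraries clash. *)
From HB Require Import structures.
From mathcomp Require Import all_boot all_order all_algebra.
From mathcomp Require Import finmap mpoly.
From mathcomp Require Import all_classical all_reals.
From mathcomp Require Import ereal measure lebesgue_measure.
From mathcomp Require Import lebesgue_integral_fubini convex.

Set Implicit Arguments.
Unset Strict Implicit.
Unset Printing Implicit Defensive.

Import Order.TTheory GRing.Theory Num.Theory.

Local Open Scope classical_set_scope.
Local Open Scope ring_scope.

Section Plane.
Variable R : realType.
Implicit Types C D : set (R * R).

Definition convex_hull (S : set (R * R)) : set (R * R) :=
  smallest (@convex_set R (R * R)%type) S.

Definition minkowski_sum C D : set (R * R) :=
  [set x + y | x in C & y in D].

Definition area C : \bar R :=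
  (@lebesgue_measure R \x @lebesgue_measure R)%E C.

Definition mixed_volume C D : \bar R :=
  (area (minkowski_sum C D) - area C - area D)%E.

Definition newton_polygon (K : closedFieldType) (f : {mpoly K[2]}) :
    set (R * R) :=
  convex_hull
    [set ((m ord0)%:R, (m ord_max)%:R) | m in [set m | m \in msupp f]].

End Plane.

Arguments newton_polygon R {K} f.

Section Zariski.
Variables (K : closedFieldType) (n : nat).

(* The affine space K^n is 'rV[K]_n; P.@[c 0] is the value of P at c.  An open
   set is the complement of the zero locus of a set F of polynomials. *)
Definition zariski_open (U : set 'rV[K]_n) : Prop :=
  exists F : set {mpoly K[n]},
    U = [set c | exists2 P, F P & P.@[c 0] != 0].

End Zariski.

Section Coefficients.
Variable K : closedFieldType.

Definition coef_row (A : {fset 'X_{1..2}}) (f : {mpoly K[2]}) :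
    'rV[K]_(#|` A|) :=
  \row_i f@_(nth 0%MM A i).

Definition coef_vector (A B : {fset 'X_{1..2}}) (f g : {mpoly K[2]}) :
    'rV[K]_(#|` A| + #|` B|) :=
  row_mx (coef_row A f) (coef_row B g).

End Coefficients.

Section Roots.
Variable K : closedFieldType.
Implicit Types (f g a b : {mpoly K[2]}) (p : 'rV[K]_2).

(* The local ring O_p of the affine plane at p, inside K(x, y). *)
Definition local_ring p : set {fraction {mpoly K[2]}} :=
  [set z | exists a b, b.@[p 0] != 0 /\ z = tofrac a / tofrac b].

(* The ideal of O_p generated by f and g. *)
Definition local_ideal f g p : set {fraction {mpoly K[2]}} :=
  [set u * tofrac f + v * tofrac g | u in local_ring p & v in local_ring p].

(* dim_K O_p / (f, g) = k: the classes of e_0, ..., e_(k-1) are a K-basis.  No k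
   qualifies when this dimension is infinite. *)
Definition intersection_multiplicity f g p (k : nat) : Prop :=
  exists e : 'I_k -> {fraction {mpoly K[2]}},
    (forall i, local_ring p (e i)) /\
    (forall z, local_ring p z ->
       exists! c : 'rV[K]_k,
         local_ideal f g p (z - \sum_(i < k) tofrac (c 0 i)%:MP * e i)).

Definition common_torus_root f g p : Prop :=
  [/\ forall i, p 0 i != 0, f.@[p 0] = 0 & g.@[p 0] = 0].

(* There are finitely many common roots in the torus, each of finite
   multiplicity, and the multiplicities add up to N. *)
Definition torus_root_count f g (N : nat) : Prop :=
  exists (s : seq 'rV[K]_2) (mult : 'rV[K]_2 -> nat),
    [/\ uniq s,
        forall p, p \in s <-> common_torus_root f g p,
        forall p, p \in s -> intersection_multiplicity f g p (mult p) &
        N = (\sum_(p <- s) mult p)%N].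

End Roots.

(* Main.v *)
(* Write f and g, up to monomials, as polynomials of degrees d and e in y (the
   first variable) over K[x].  If their top coefficients are coprime in
   K[x, 1/x], and so are their bottom coefficients, then the quotient of
   K[x, 1/x, y, 1/y] by (f, g) is the cokernel of the Sylvester matrix over
   K[x, 1/x], whose dimension over K is the length of the interval spanned by
   the exponents of the determinant D.  That dimension is also the sum of the
   multiplicities of the roots in the torus.

   The order of D at x = 0 only involves the lower boundaries p and q of the two
   Newton polygons.  Merging their unit steps by increasing slope gives the
   lower boundary of the Minkowski sum, and assigns to each step of q a row
   y^j f and to each step of p a row y^i g.  Along the corresponding transversal
   of the Sylvester matrix all the coefficients are at vertices, and the sum of
   their heights is both the least possible order of D and the area under the
   boundary of the sum minus the areas under p and q.  A lexicographically
   minimal monomial of D occurs only in that transversal, hence with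
   coefficient 1 or -1 in every characteristic, so that the bound is reached
   generically.  The same holds at infinity for the upper boundaries, and the
   difference of the two exponents is the mixed volume. *)
Require Import Defs.
From HB Require Import structures.
From mathcomp Require Import all_boot all_order all_algebra.
From mathcomp Require Import finmap mpoly.
From mathcomp Require Import all_classical all_reals.
From mathcomp Require Import ereal measure lebesgue_measure.
From mathcomp Require Import lebesgue_integral_fubini convex.
From mathcomp Require Import fingroup perm ring lra zify.
From mathcomp Require Import normedtype derive ftc measurable_realfun lebesgue_integral.

Set Implicit Arguments.
Unset Strict Implicit.
Unset Printing Implicit Defensive.

Import Order.TTheory GRing.Theory Num.Theory.

Local Open Scope classical_set_scope.
Local Open Scope ring_scope.

(** * Codimension *)

(** No quotient ring is formed: dimensions are codimensions of K-subspaces of K[x][y] or of row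
    vectors over K[x], and Laurent denominators become extra powers of x and y in the relations that
    define these subspaces. Finite dimension then does the work of inverting: an injective
    endomorphism of a quotient is onto, so powers of x, the product xy, and functions that do not
    vanish at a point can be inverted modulo the relevant subspace. The dimension is distributed
    over points by a composition series with one-dimensional factors, each carried by a single
    point. A point on an axis carries none, because xy acts invertibly. The bound on the order of D
    is linear programming duality for the assignment problem: the merged boundary provides
    potentials for which every entry has nonnegative reduced cost. The obstacle is parallel edges,
    where several transversals reach the bound and their terms could cancel. One parameter t,
    together with the rule that p moves first, singles out one of them. *)

Section Codimension.
Variables (K : fieldType) (V : lmodType {poly K}).
Implicit Types (J : set V) (k : nat).

(** V is a module over [{poly K}]; K acts through constant polynomials. V will be K[x][y] as well as
    a space of rows over K[x]. *)
Definition subspace J :=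
  J 0 /\ forall a x y, J x -> J y -> J (a%:P *: x + y).

(** The dimension of V/J without the quotient, in the same form as [intersection_multiplicity], so
    that bases can be carried over directly. *)
Definition codim J k := exists e : 'I_k -> V, forall z,
  exists! c : 'rV[K]_k, J (z - \sum_i (c 0 i)%:P *: e i).

Definition adjoin J v : set V := [set z | exists a, J (z - a%:P *: v)].

Definition klinear (W : lmodType K) (T : V -> W) :=
  forall a x y, T (a%:P *: x + y) = a *: T x + T y.

Lemma subspaceD J x y : subspace J -> J x -> J y -> J (x + y).
Proof. by move=> [_ h] Jx Jy; have := h 1 _ _ Jx Jy; rewrite scale1r. Qed.

Lemma subspaceZ J a x : subspace J -> J x -> J (a%:P *: x).
Proof. by move=> [J0 h] Jx; have := h a _ _ Jx J0; rewrite addr0. Qed.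

Lemma subspaceN J x : subspace J -> J x -> J (- x).
Proof.
by move=> sJ /(subspaceZ (-1) sJ); rewrite polyCN scaleNr scale1r.
Qed.

Lemma subspaceB J x y : subspace J -> J x -> J y -> J (x - y).
Proof. by move=> sJ Jx /(subspaceN sJ); apply: subspaceD. Qed.

Lemma adjoin_subspace J v : subspace J -> subspace (adjoin J v).
Proof.
move=> sJ; split.
  by exists 0; rewrite polyC0 scale0r subr0; exact: (proj1 sJ).
move=> a x y [b hb] [c hc]; exists (a * b + c).
have := (proj2 sJ) a _ _ hb hc; congr (J _).
by rewrite polyCD polyCM scalerDl scalerBr scalerA opprD addrACA.
Qed.

(** Prepending v to a basis modulo [adjoin J v] gives a basis modulo J; the coefficient of v is
    unique because v is not in J. *)
Lemma codim_adjoin J v k :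
  subspace J -> ~ J v -> codim (adjoin J v) k -> codim J k.+1.
Proof.
move=> sJ nJv [e he].
pose e' i := oapp e v (unlift ord0 i).
have sumE (c : 'rV[K]_k.+1) : \sum_i (c 0 i)%:P *: e' i =
    (c 0 ord0)%:P *: v + \sum_i ((\row_i c 0 (lift ord0 i)) 0 i)%:P *: e i.
  rewrite big_ord_recl /e' unlift_none /=; congr (_ + _).
  by apply: eq_bigr => i _; rewrite liftK mxE.
exists e' => z; have [c [[a Ja] cU]] := he z.
exists (\row_i oapp (c 0) a (unlift ord0 i)); split=> [|d].
  rewrite sumE mxE unlift_none /=.
  suff -> : \row_i (\row_i0 oapp (c 0) a (unlift ord0 i0)) 0 (lift ord0 i) = c.
    by move: Ja; rewrite opprD addrA addrAC.
  by apply/rowP => i; rewrite !mxE liftK.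
rewrite sumE => Jd.
have dE : c = \row_i d 0 (lift ord0 i).
  by apply: cU; exists (d 0 ord0); move: Jd; rewrite opprD addrA addrAC.
apply/rowP => i; rewrite mxE; case: unliftP => [j ->|->] /=.
  by rewrite dE mxE.
rewrite -dE in Jd; apply/eqP/negPn/negP => ne; apply: nJv.
have := subspaceB sJ Ja Jd.
set w := z - _; have -> : w - a%:P *: v - (z - ((d 0 ord0)%:P *: v +
    \sum_i (c 0 i)%:P *: e i)) = (d 0 ord0 - a)%:P *: v.
  rewrite polyCB scalerBl /w -[z - (\sum_i _)]opprB [- (z - _)]opprB.
  by rewrite -[(_ + _) - z]addrA [_ + (_ - z)]addrC addrACA addNr add0r addrC.
move=> /(subspaceZ (d 0 ord0 - a)^-1 sJ).
by rewrite scalerA -polyCM mulVf ?scale1r // subr_eq0 eq_sym.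
Qed.

Lemma codim_coord J k : subspace J -> codim J k ->
  exists T : V -> 'rV[K]_k, [/\ klinear T, forall x, J x <-> T x = 0 &
    forall w, exists x, T x = w].
Proof.
move=> sJ [e he].
have [T hT] := choice he.
have TU x (c : 'rV[K]_k) : J (x - \sum_i (c 0 i)%:P *: e i) -> T x = c.
  by move=> Jx; exact: (proj2 (hT x)).
exists T; split => [a x y|x|w].
- apply: TU; have := (proj2 sJ) a _ _ (proj1 (hT x)) (proj1 (hT y)).
  congr (J _); rewrite scalerBr addrACA -opprD; congr (_ - _).
  rewrite scaler_sumr -big_split /=; apply: eq_bigr => i _.
  by rewrite !mxE polyCD polyCM scalerDl scalerA.
- split=> [Jx|Tx0].
    by apply: TU; rewrite big1 ?subr0 // => i _; rewrite mxE polyC0 scale0r.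
  have := proj1 (hT x); rewrite Tx0 big1 ?subr0 // => i _.
  by rewrite mxE polyC0 scale0r.
- exists (\sum_i (w 0 i)%:P *: e i); apply: TU.
  by rewrite subrr; exact: (proj1 sJ).
Qed.

Lemma klinear0 (W : lmodType K) (T : V -> W) : klinear T -> T 0 = 0.
Proof.
move=> h; have := h (-1) 0 0.
by rewrite scaler0 addr0 scaleN1r addNr.
Qed.

Lemma klinearZ (W : lmodType K) (T : V -> W) a x : klinear T ->
  T (a%:P *: x) = a *: T x.
Proof. by move=> h; have := h a x 0; rewrite !addr0 klinear0 // addr0. Qed.

Lemma klinearD (W : lmodType K) (T : V -> W) x y : klinear T ->
  T (x + y) = T x + T y.
Proof. by move=> h; have := h 1 x y; rewrite !scale1r. Qed.

Lemma klinearB (W : lmodType K) (T : V -> W) x y : klinear T ->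
  T (x - y) = T x - T y.
Proof.
move=> h; rewrite klinearD //; congr (_ + _).
by have := klinearZ (-1) y h; rewrite polyCN scaleNr scale1r scaleN1r.
Qed.

Lemma klinear_sum (W : lmodType K) (T : V -> W) I (r : seq I) (F : I -> V) :
  klinear T -> T (\sum_(i <- r) F i) = \sum_(i <- r) T (F i).
Proof.
move=> h; elim: r => [|i r IH]; first by rewrite !big_nil klinear0.
by rewrite !big_cons klinearD // IH.
Qed.

Lemma coord_codim J k (T : V -> 'rV[K]_k) :
  klinear T -> (forall x, J x <-> T x = 0) -> (forall w, exists x, T x = w) ->
  codim J k.
Proof.
move=> lT kT sT.
have [e he] := choice (fun i : 'I_k => sT (delta_mx 0 i)).
exists e => z; have TE (c : 'rV[K]_k) : T (\sum_i (c 0 i)%:P *: e i) = c.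
  rewrite klinear_sum // [RHS]row_sum_delta.
  by apply: eq_bigr => i _; rewrite klinearZ // he.
exists (T z); split=> [|c /kT].
  by apply/kT; rewrite klinearB // TE subrr.
by rewrite klinearB // TE => /eqP; rewrite subr_eq0 => /eqP.
Qed.

(** In coordinates T modulo J, [T v] is a nonzero row of length k + 1. Multiplying by a column basis
    of its cokernel matrix, of rank k, kills exactly the line of [T v]. *)
Lemma codim_drop J v k :
  subspace J -> ~ J v -> codim J k.+1 -> codim (adjoin J v) k.
Proof.
move=> sJ nJv /(codim_coord sJ)[T [lT kT sT]].
have Tv0 : T v != 0 by apply/eqP => /kT.
pose C := cokermx (T v).
have rC : \rank C = k by rewrite mxrank_coker rank_rV Tv0 subn1.
suff : codim (adjoin J v) (\rank C) by rewrite rC.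
apply: (@coord_codim _ _ (fun x => T x *m col_base C)).
- by move=> a x y; rewrite lT mulmxDl scalemxAl.
- move=> x; have -> : T x *m col_base C = 0 <-> (T x <= T v)%MS.
    have CE := mulmx_base C; rewrite submxE -/C; split=> [h|/eqP].
      by rewrite -CE mulmxA h mul0mx.
    rewrite -{1}CE mulmxA => h; apply: (row_free_inj (row_base_free C)).
    by rewrite /= h mul0mx.
  split=> [[a /kT]|/sub_rVP[a Ta]].
    rewrite klinearB // klinearZ // => /eqP; rewrite subr_eq0 => /eqP ->.
    by rewrite scalemx_sub.
  by exists a; apply/kT; rewrite klinearB // klinearZ // Ta subrr.
- move=> w; have [x Tx] := sT (w *m pinvmx (col_base C)).
  exists x; rewrite Tx mulmxKpV //.
  by apply: submx_full; exact: col_base_full.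
Qed.

(** The second condition on phi makes it an injective endomorphism of V/J, and in finite dimension
    its matrix A is invertible. Every later inversion of a multiplication map rests on this. *)
Lemma codim_surj J k (phi : V -> V) : subspace J -> codim J k ->
  (forall a x y, phi (a%:P *: x + y) = a%:P *: phi x + phi y) ->
  (forall x, J (phi x) <-> J x) -> forall z, exists x, J (z - phi x).
Proof.
move=> sJ /(codim_coord sJ)[T [lT kT sT]] lphi kphi z.
have [e he] := choice (fun i : 'I_k => sT (delta_mx 0 i)).
pose A := \matrix_i T (phi (e i)).
have lTp : klinear (T \o phi) by move=> a x y /=; rewrite lphi lT.
have TE (c : 'rV[K]_k) : T (\sum_i (c 0 i)%:P *: e i) = c.
  rewrite klinear_sum // [RHS]row_sum_delta.
  by apply: eq_bigr => i _; rewrite klinearZ // he.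
have TpE (c : 'rV[K]_k) : T (phi (\sum_i (c 0 i)%:P *: e i)) = c *m A.
  have /= -> := klinear_sum (index_enum 'I_k) (fun i => (c 0 i)%:P *: e i) lTp.
  rewrite mulmx_sum_row; apply: eq_bigr => i _.
  by have /= -> := klinearZ (c 0 i) (e i) lTp; rewrite rowK.
have fA : row_free A.
  apply: inj_row_free => w; rewrite -TpE => /kT /kphi /kT.
  by rewrite TE.
have uA : A \in unitmx by rewrite -row_free_unit.
exists (\sum_i ((T z *m invmx A) 0 i)%:P *: e i).
by apply/kT; rewrite klinearB // TpE mulmxKV // subrr.
Qed.

Lemma codim_unique0 J : subspace J -> codim J 0 <-> forall z, J z.
Proof.
move=> sJ; split=> [[e he] z|h].
  by have [c [+ _]] := he z; rewrite big_ord0 subr0.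
exists (fun=> 0) => z; exists 0; split=> [|c _]; last by rewrite [c]thinmx0.
by rewrite big_ord0 subr0.
Qed.

Lemma codim_full J k : (forall z, J z) -> codim J k -> k = 0%N.
Proof.
move=> Jz; case: k => // k [e he]; have [c [_ cU]] := he 0.
have e0 := cU (const_mx 0) (Jz _); have e1 := cU (const_mx 1) (Jz _).
have /rowP/(_ ord0) : const_mx 0 = const_mx 1 :> 'rV[K]_k.+1.
  by rewrite -e0 -e1.
by rewrite !mxE => /esym/eqP; rewrite oner_eq0.
Qed.

End Codimension.

(** * Localizations of an ideal of finite codimension *)

Section Localization.
Variable K : closedFieldType.
Local Notation S := {poly {poly K}}.
Implicit Types (J : set S) (q : K * K) (h b : S).

Definition ideal J :=
  [/\ J 0, forall x y, J x -> J y -> J (x + y) & forall a x, J x -> J (a * x)].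

(** The first coordinate of q is the value of the outer variable, the second that of the coefficient
    variable. *)
Definition ev h q : K := (h.[q.1%:P]).[q.2].

(** The contraction to S of the extension of J to the local ring at q. *)
Definition localize J q : set S := [set h | exists2 b, ev b q != 0 & J (b * h)].

Lemma evM a b q : ev (a * b) q = ev a q * ev b q.
Proof. by rewrite /ev !hornerM. Qed.

Lemma evD a b q : ev (a + b) q = ev a q + ev b q.
Proof. by rewrite /ev !hornerD. Qed.

Lemma evB a b q : ev (a - b) q = ev a q - ev b q.
Proof. by rewrite /ev !hornerE. Qed.

Lemma evC (a : K) q : ev a%:P%:P q = a.
Proof. by rewrite /ev !hornerE. Qed.

Lemma evX q : ev 'X q = q.1.
Proof. by rewrite /ev !hornerE. Qed.

Lemma evXC q : ev 'X%:P q = q.2.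
Proof. by rewrite /ev !hornerE. Qed.

Lemma ev_residue b q : exists r s,
  b = (ev b q)%:P%:P + r * ('X - q.1%:P%:P) + s * ('X%:P - q.2%:P%:P).
Proof.
have /factor_theorem[r hr] : root (b - (b.[q.1%:P])%:P) q.1%:P.
  by rewrite rootE !hornerE subrr.
have /factor_theorem[s hs] : root (b.[q.1%:P] - (ev b q)%:P) q.2.
  by rewrite rootE !hornerE subrr.
exists r, s%:P; rewrite -hr -polyCB -polyCM -hs polyCB.
by move: (_%:P) (_%:P) => u v; ring.
Qed.

Lemma ideal_subspace J : ideal J -> subspace J.
Proof.
move=> [J0 JD JM]; split=> // a x y Jx Jy; apply: JD => //.
by rewrite -mul_polyC; apply: JM.
Qed.

Lemma localize_ideal J q : ideal J -> ideal (localize J q).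
Proof.
move=> [J0 JD JM]; split.
- by exists 1; rewrite ?mulr0 // evC oner_eq0.
- move=> x y [b bq Jb] [c cq Jc]; exists (b * c); rewrite ?evM ?mulf_neq0 //.
  rewrite mulrDr; apply: JD; last by rewrite -mulrA; apply: JM.
  by rewrite [b * c]mulrC -mulrA; apply: JM.
- by move=> a x [b bq Jb]; exists b => //; rewrite mulrCA; apply: JM.
Qed.

Lemma sub_localize J q h : J h -> localize J q h.
Proof. by move=> Jh; exists 1; rewrite ?mul1r // evC oner_eq0. Qed.

(** Multiplying u by the factors one at a time, the last product outside J is an eigenvector of
    theta modulo J. *)
Lemma ideal_walk J (theta : S) (l : seq K) u : ideal J -> ~ J u ->
  J (\prod_(a <- l) (theta - a%:P%:P) * u) ->
  exists a w, ~ J (w * u) /\ J ((theta - a%:P%:P) * (w * u)).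
Proof.
move=> iJ nJu; elim: l => [|a l IH]; first by rewrite big_nil mul1r.
rewrite big_cons -mulrA => Jl.
have [/IH//|nJ] := pselect (J (\prod_(j <- l) (theta - j%:P%:P) * u)).
by exists a, (\prod_(j <- l) (theta - j%:P%:P)).
Qed.

(** The k + 1 powers of theta up to the k-th are linearly dependent modulo J, and the resulting
    nonzero polynomial splits over K. *)
Lemma ideal_relation J k (theta : S) : ideal J -> codim J k ->
  exists l : seq K, J (\prod_(a <- l) (theta - a%:P%:P)).
Proof.
move=> iJ cJ; have [T [lT kT _]] := codim_coord (ideal_subspace iJ) cJ.
pose A := \matrix_(i < k.+1) T (theta ^+ i).
have [c [cN0 cA]] : exists c : 'rV_k.+1, c != 0 /\ c *m A = 0.
  apply: contrapT => nc; have /eqP : row_free A.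
    apply: inj_row_free => v vA; apply/eqP; apply: contraT => vN0.
    by case: nc; exists v.
  by move=> e; have := rank_leq_col A; rewrite e ltnn.
pose p := \poly_(i < k.+1) oapp (c 0) 0 (insub i : option 'I_k.+1).
have pE (i : 'I_k.+1) : p`_i = c 0 i by rewrite coef_poly ltn_ord valK.
have pN0 : p != 0.
  apply: contra cN0 => /eqP p0; apply/eqP/rowP => i.
  by rewrite -pE p0 coef0 mxE.
have Jp : J (map_poly (polyC \o polyC) p).[theta].
  apply/kT; rewrite (@horner_coef_wide _ k.+1); last first.
    by rewrite (leq_trans (size_poly _ _)) // size_poly.
  rewrite -[RHS]cA mulmx_sum_row klinear_sum //; apply: eq_bigr => i _.
  by rewrite coef_map /= pE mul_polyC klinearZ // rowK.
have [l pl] := closed_field_poly_normal p; exists l.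
have lcN0 : lead_coef p != 0 by rewrite lead_coef_eq0.
case: iJ => _ _ /(_ (lead_coef p)^-1%:P%:P _ Jp).
rewrite {2}pl -mul_polyC rmorphM /= map_polyC hornerM hornerC /= mulrA.
rewrite -!polyCM mulVf // !polyC1 mul1r rmorph_prod horner_prod.
congr J; apply: eq_bigr => a _.
by rewrite rmorphB /= map_polyX map_polyC !hornerE.
Qed.

(** A walk from 1 yields an eigenvector of the outer variable. A second walk from there, along the
    inner variable, only multiplies it by polynomials and so keeps the first eigenvalue relation. *)
Lemma exists_socle J k : ideal J -> codim J k.+1 -> exists v q,
  [/\ ~ J v, J (('X - q.1%:P%:P) * v) & J (('X%:P - q.2%:P%:P) * v)].
Proof.
move=> iJ cJ; have [J0 JD JM] := iJ.
have nJ1 : ~ J 1.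
  move=> J1; have [T [_ kT sT]] := codim_coord (ideal_subspace iJ) cJ.
  have [x Tx] := sT (const_mx 1).
  have /kT : J x by rewrite -[x]mulr1; apply: JM.
  rewrite Tx => /rowP/(_ ord0); rewrite !mxE => /eqP; by rewrite oner_eq0.
have [l Jl] := ideal_relation 'X iJ cJ.
rewrite -[\prod_(_ <- _) _]mulr1 in Jl.
have [a [w [nJw Jw]]] := ideal_walk iJ nJ1 Jl.
have [m Jm] := ideal_relation 'X%:P iJ cJ.
have := JM (w * 1) _ Jm; rewrite mulrC => Jm'.
have [b [z [nJz Jz]]] := ideal_walk iJ nJw Jm'.
exists (z * (w * 1)), (a, b); split => //=.
by rewrite mulrCA; apply: JM.
Qed.

Lemma socle_mul J v q b : ideal J -> J (('X - q.1%:P%:P) * v) ->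
  J (('X%:P - q.2%:P%:P) * v) -> J (b * v - (ev b q)%:P%:P * v).
Proof.
move=> [J0 JD JM] Jx Jy; have [r [s bE]] := ev_residue b q.
have -> : b * v - (ev b q)%:P%:P * v =
    r * (('X - q.1%:P%:P) * v) + s * (('X%:P - q.2%:P%:P) * v).
  by rewrite {1}bE; move: (_%:P%:P) => u; ring.
by apply: JD; apply: JM.
Qed.

Lemma adjoin_socle_ideal J v q : ideal J -> J (('X - q.1%:P%:P) * v) ->
  J (('X%:P - q.2%:P%:P) * v) -> ideal (adjoin J v).
Proof.
move=> iJ Jx Jy; have sA := adjoin_subspace v (ideal_subspace iJ).
split; first exact: (proj1 sA).
  by move=> x y; apply: subspaceD.
move=> b x [a Ja]; exists (ev b q * a); have [J0 JD JM] := iJ.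
have := JD _ _ (JM b _ Ja) (JM a%:P%:P _ (socle_mul b iJ Jx Jy)).
congr J; rewrite -!mul_polyC !mulrBr addrA mulrCA subrK.
by rewrite polyCM polyCM mulrA [a%:P%:P * _]mulrC.
Qed.

(* Induction along a composition series of the quotient by J: a joint
   eigenvector v of x and y, with eigenvalues p, contributes one dimension to
   the localization at p and none to the other localizations. *)
Lemma ideal_localize_codims N J : ideal J -> codim J N ->
  exists2 s : seq (K * K), size s = N &
    forall q, codim (localize J q) (count_mem q s).
Proof.
elim: N J => [|N IH] J iJ cJ.
  exists [::] => // q; apply/codim_unique0.
    exact/ideal_subspace/localize_ideal.
  by move/(codim_unique0 (ideal_subspace iJ)): cJ => cJ z; apply: sub_localize.
have [v [p [nJv Jx Jy]]] := exists_socle iJ cJ.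
have sJ := ideal_subspace iJ.
have iA := adjoin_socle_ideal iJ Jx Jy.
have [s sN hs] := IH _ iA (codim_drop sJ nJv cJ).
exists (p :: s) => [|q]; first by rewrite /= sN.
have [J0 JD JM] := iJ.
have [<-|ne] := eqVneq p q; last first.
  rewrite /= (negPf ne) add0n; suff -> : localize J q = localize (adjoin J v) q.
    exact: hs.
  (* A coordinate in which p and q differ gives a linear polynomial that kills v modulo J and is a
     unit at q, so v already lies in the localization of J at q. *)
  have [t tq Jt] : exists2 t, ev t q != 0 & J (t * v).
    have [e1|ne1] := eqVneq p.1 q.1; last first.
      by exists ('X - p.1%:P%:P); rewrite // evB evX evC subr_eq0 eq_sym.
    exists ('X%:P - p.2%:P%:P); rewrite // evB evXC evC subr_eq0 eq_sym.
    by apply: contra ne => /eqP e2; rewrite [p]surjective_pairing e1 e2 -surjective_pairing.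
  apply/seteqP; split=> h [b bq].
    by move=> Jb; exists b => //; exists 0; rewrite polyC0 scale0r subr0.
  move=> [a Ja]; exists (t * b); first by rewrite evM mulf_neq0.
  have := JD _ _ (JM t _ Ja) (JM a%:P%:P _ Jt).
  by congr J; rewrite -mul_polyC mulrBr mulrA [t * (_ * v)]mulrCA subrK.
rewrite /= eqxx add1n; apply: (@codim_adjoin _ _ _ v).
- exact/ideal_subspace/localize_ideal.
- move=> [b bq Jb]; apply: nJv.
  have := JD _ _ Jb (JM (-1) _ (socle_mul b iJ Jx Jy)).
  rewrite mulN1r opprB addrCA subrr addr0 => /(JM (ev b p)^-1%:P%:P).
  by rewrite mulrA -!polyCM mulVf // !polyC1 mul1r.
(* Adjoining v commutes with localizing at p: modulo J a denominator b multiplies v by the nonzero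
   scalar b(p). *)
- suff -> : adjoin (localize J p) v = localize (adjoin J v) p by exact: hs.
  apply/seteqP; split=> h.
    move=> [a [b bq Jb]]; exists b => //; exists (ev b p * a).
    have := JD _ _ Jb (JM a%:P%:P _ (socle_mul b iJ Jx Jy)).
    congr J; rewrite -!mul_polyC !mulrBr addrA mulrCA subrK.
    by rewrite polyCM polyCM mulrA [a%:P%:P * _]mulrC.
  move=> [b bp [a Ja]]; exists (a / ev b p); exists b => //.
  have := JD _ _ Ja (JM (- (a / ev b p)%:P%:P) _ (socle_mul b iJ Jx Jy)).
  have aE : a%:P%:P = (a / ev b p)%:P%:P * (ev b p)%:P%:P :> S.
    by rewrite -!polyCM mulfVK.
  congr J; rewrite -!mul_polyC aE.
  by move: (_%:P%:P) (_%:P%:P) => u w; ring.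
Qed.

End Localization.

(** * Cokernel of a polynomial matrix *)

Section Saturation.
Variable K : closedFieldType.

(** The contraction to K[x]^n of the row module of M over K[x, 1/x]. *)
Definition saturation n (M : 'M[{poly K}]_n) : set 'rV[{poly K}]_n :=
  [set w | exists k u, 'X^k *: w = u *m M].

Lemma saturation_subspace n (M : 'M[{poly K}]_n) : subspace (saturation M).
Proof.
split; first by exists 0, 0; rewrite scaler0 mul0mx.
move=> a x y [k [u hu]] [l [v hv]].
exists (k + l)%N, (a%:P *: ('X^l *: u) + 'X^k *: v).
rewrite mulmxDl -!scalemxAl -hu -hv scalerDr !scalerA exprD.
by congr (_ *: _ + _); ring.
Qed.

Definition scale_row0 n (b : K) : 'M[{poly K}]_n.+1 :=
  diag_mx (\row_i if i == 0 then 'X - b%:P else 1).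

Lemma mul_scale_row0 n b (u : 'rV[{poly K}]_n.+1) i :
  (u *m scale_row0 n b) 0 i = u 0 i * if i == 0 then 'X - b%:P else 1.
Proof. by rewrite mul_mx_diag !mxE. Qed.

Lemma det_scale_row0 n b : \det (scale_row0 n b) = 'X - b%:P.
Proof.
rewrite det_diag big_ord_recl !mxE eqxx big1 ?mulr1 // => i _.
by rewrite mxE.
Qed.

(** A nonzero row w kills M(b). The constant invertible matrix [row_ebase w] has first row
    proportional to w, so the first row of its product with M is divisible by X - b. A constant
    invertible factor preserves the row module and multiplies the determinant by a scalar. *)
Lemma det_root_split n (M : 'M[{poly K}]_n.+1) b : root (\det M) b ->
  exists M' (c : K), [/\ c != 0, ('X - b%:P) * \det M' = c%:P * \det M &
    saturation M = saturation (scale_row0 n b *m M')].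
Proof.
move=> rb; pose Mb := map_mx (horner_eval b) M.
have /eqP/det0P[w wN0 wM] : \det Mb = 0.
  by rewrite det_map_mx /= horner_evalE; apply/eqP.
pose C := row_ebase w; have uC : C \in unitmx by exact: row_ebase_unit.
have CM0 : row 0 (C *m Mb) = 0.
  have [k kN0 wE] : exists2 k, k != 0 & w = k *: row 0 C.
    have wE : w = col_ebase w 0 0 *: row 0 C.
      rewrite -[LHS]mulmx_ebase {1}[col_ebase w]mx11_scalar mul_scalar_mx.
      rewrite rank_rV wN0 -scalemxAl rowE; congr (_ *: (_ *m _)).
      apply/rowP => i; rewrite !mxE eqxx /= -val_eqE /= andbT eq_sym.
      by case: (val i).
    exists (col_ebase w 0 0) => //.
    by apply: contraNneq wN0 => c0; rewrite wE c0 scale0r.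
  apply: (scalerI kN0); rewrite scaler0 row_mul.
  by rewrite scalemxAl -wE.
pose CP := map_mx polyC C; pose M1 := CP *m M.
have M1b j : root (M1 0 j) b.
  have /rowP/(_ j) := CM0; rewrite !mxE rootE => e; apply/eqP; rewrite -[RHS]e.
  rewrite horner_sum; apply: eq_bigr => i _.
  by rewrite !mxE hornerM hornerC horner_evalE.
pose M' := \matrix_(i, j) if i == 0 then M1 i j %/ ('X - b%:P) else M1 i j.
have M1E : M1 = scale_row0 n b *m M'.
  apply/matrixP => i j; rewrite mul_diag_mx !mxE.
  case: eqVneq => [->|_]; last by rewrite mul1r.
  by have := M1b j; rewrite !mxE mulrC => rj; rewrite divpK // dvdp_XsubCl.
exists M', (\det C); split.
- by rewrite -unitfE -unitmxE uC.
- by rewrite -(det_scale_row0 n) -det_mulmx -M1E det_mulmx det_map_mx.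
- have Ci : map_mx polyC (invmx C) *m CP = 1%:M.
    by rewrite -map_mxM mulVmx // map_mx1.
  rewrite -M1E; apply/seteqP; split => v [k [u hu]]; exists k.
    by exists (u *m map_mx polyC (invmx C)); rewrite hu mulmxA -[_ *m _ *m CP]mulmxA Ci mulmx1.
  by exists (u *m CP); rewrite hu mulmxA.
Qed.

(* A root b of the determinant gives a combination of the rows that vanishes at
   b.  Dividing it by X - b enlarges the row module by one dimension, except
   that nothing changes for b = 0 because of the saturation. *)
Lemma saturation_codim n (M : 'M[{poly K}]_n) a D :
  \det M = 'X^a * D -> ~~ root D 0 -> codim (saturation M) (size D).-1.
Proof.
have [m] := ubnP (size (\det M)).
elim: m n M a D => // m IH n M a D szM detM D0.
have DN0 : D != 0 by apply: contraNneq D0 => ->; rewrite root0.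
have detN0 : \det M != 0 by rewrite detM mulf_neq0 // monic_neq0 // monicXn.
have [/eqP sz1|/closed_rootP[b0 rb0]] := boolP (size (\det M) == 1%N).
  have -> : (size D).-1 = 0%N.
    move: sz1; rewrite detM size_proper_mul ?lead_coefXn ?mul1r ?lead_coef_eq0 //.
    by rewrite size_polyXn /= -subn1; lia.
  apply/(codim_unique0 (saturation_subspace M)) => z.
  exists 0%N, (z *m invmx M); rewrite scale1r mulmxKV // unitmxE.
  have /size_poly1P[c cN0 ->] : size (\det M) == 1%N by exact/eqP.
  by rewrite poly_unitE size_polyC cN0 coefC /= unitfE.
case: n M detM szM detN0 rb0 => [|n] M detM szM detN0 rb0.
  by move: rb0; rewrite det_mx00 (negPf (root1 _)).
case: a detM => [|a] detM.
  rewrite expr0 mul1r in detM; rewrite -detM in D0 DN0 *.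
  have b0N0 : b0 != 0 by apply: contraNneq D0 => <-.
  have [M' [c [cN0 detM' ->]]] := det_root_split rb0.
  have detM'N0 : \det M' != 0.
    apply: contraNneq detN0 => d0; move: detM'; rewrite d0 mulr0 => /esym/eqP.
    by rewrite mulf_eq0 polyC_eq0 (negPf cN0).
  have szM' : size (\det M) = (size (\det M')).+1.
    rewrite -(size_Cmul (\det M) cN0) -detM' mulrC size_Mmonic ?monicXsubC //.
    by rewrite size_XsubC addnC.
  have cM' : codim (saturation M') (size (\det M')).-1.
    apply: (IH _ M' 0%N); first by rewrite -ltnS -szM'.
      by rewrite expr0 mul1r.
    apply: contra D0; rewrite !rootE => /eqP d0.
    have := congr1 (fun p => p.[0]) detM'; rewrite !hornerE d0 mulr0.
    by move=> /esym/eqP; rewrite mulf_eq0 (negPf cN0).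
  have szM'0 : (0 < size (\det M'))%N.
    by rewrite size_poly_gt0.
  have -> : (size (\det M)).-1 = (size (\det M')).-1.+1 by rewrite szM' /= prednK.
  pose v := row 0 M'; apply: (@codim_adjoin _ _ _ v).
  - exact: saturation_subspace.
  (* Since multiplication by M' is injective, membership would give x^k = u_0 (x - b0), which fails
     at x = b0 because b0 is nonzero. *)
  - move=> [k [u hu]]; rewrite /v rowE mulmxA scalemxAl in hu.
    have fM' : injective (fun x : 'rV_n.+1 => x *m M').
      move=> x y /= xy; have := congr1 (mulmx^~ (\adj M')) xy.
      rewrite -!mulmxA mul_mx_adj !mul_mx_scalar => /rowP e.
      apply/rowP => i; have := e i; rewrite !mxE.
      by apply: mulfI; exact: detM'N0.
    have /rowP/(_ 0) := fM' _ _ hu.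
    rewrite mul_scale_row0 !mxE !eqxx mulr1 => /(congr1 (horner^~ b0)).
    rewrite !hornerE subrr mulr0 => /eqP.
    by rewrite expf_eq0 (negPf b0N0) andbF.
  - suff -> : adjoin (saturation (scale_row0 n b0 *m M')) v = saturation M' by [].
    apply/seteqP; split => w.
      move=> [t [k [u hu]]]; exists k, (u *m scale_row0 n b0 + 'X^k *: (t%:P *: delta_mx 0 0)).
      rewrite mulmxDl -mulmxA -hu -!scalemxAl -rowE -/v -scalerDr subrK //.
    (* This scalar makes the first coefficient of z - t x^k e_0 vanish at b0, hence divisible by X -
       b0. *)
    move=> [k [z hz]]; exists ((z 0 0).[b0] / b0 ^+ k).
    set t := (_ / _); pose y := z - 'X^k *: (t%:P *: delta_mx 0 0).
    have yE : 'X^k *: (w - t%:P *: v) = y *m M'.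
      by rewrite scalerBr hz mulmxBl -!scalemxAl -rowE.
    have ry : root (y 0 0) b0.
      rewrite rootE !mxE !eqxx mulr1 hornerD hornerN hornerM hornerXn hornerC mulrC divfK ?subrr //.
      by rewrite expf_neq0.
    exists k, (\row_i if i == 0 then y 0 i %/ ('X - b0%:P) else y 0 i).
    rewrite yE mulmxA; congr (_ *m _); apply/rowP => i.
    rewrite mul_scale_row0 [(\row_i0 _) _ _]mxE; case: eqVneq => [->|_]; last by rewrite mulr1.
    by rewrite divpK // dvdp_XsubCl.
have rb : root (\det M) 0.
  by rewrite detM rootM rootE hornerXn exprS mul0r eqxx.
have [M' [c [cN0 detM' ->]]] := det_root_split rb.
have detM'E : \det M' = 'X^a * (c *: D).
  apply: (mulfI (monic_neq0 (monicXsubC (0 : K)))).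
  by rewrite detM' detM -mul_polyC polyC0 subr0 exprS; ring.
have -> : saturation (scale_row0 n 0 *m M') = saturation M'.
  apply/seteqP; split => w [k [u hu]].
    by exists k, (u *m scale_row0 n 0); rewrite hu mulmxA.
  exists k.+1, (\row_i if i == 0 then u 0 i else 'X * u 0 i).
  rewrite exprS -scalerA hu mulmxA scalemxAl; congr (_ *m _); apply/rowP => i.
  rewrite mul_scale_row0 !mxE polyC0 subr0.
  by case: eqVneq => _; rewrite ?mulr1 // mulrC.
rewrite -(size_scale D cN0); apply: (IH _ M' a) => //.
  have detM'N0 : \det M' != 0.
    apply: contraNneq detN0 => d0; move: detM'; rewrite d0 mulr0 => /esym/eqP.
    by rewrite mulf_eq0 polyC_eq0 (negPf cN0).
  rewrite -ltnS (leq_trans _ szM) // -(size_Cmul (\det M) cN0) -detM' mulrC.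
  by rewrite (size_Mmonic detM'N0 (monicXsubC _)) size_XsubC addnC.
by rewrite rootZ.
Qed.

End Saturation.

(** * Sylvester matrices and the torus ideal *)

Section Sylvester.

(** Rows are the multiples of f, then those of g, with coefficients in increasing degree; d and e
    are only degree bounds. The row module consists of the a f + b g with a of degree below e and b
    of degree below d. *)
Definition sylvester (R : comNzRingType) (f g : {poly R}) d e : 'M[R]_(d + e) :=
  \matrix_(r, l) (if (r < e)%N then 'X^r * f else 'X^(r - e) * g)`_l.

Lemma mul_sylvester (R : comNzRingType) (f g : {poly R}) d e u :
    (size f <= d.+1)%N -> (size g <= e.+1)%N ->
  rVpoly (u *m sylvester f g d e) =
    take_poly e (rVpoly u) * f + drop_poly e (rVpoly u) * g.
Proof.
move=> szf szg; pose P r := if (r < e)%N then 'X^r * f else 'X^(r - e) * g.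
have szX k (p : {poly R}) : (size ('X^k * p)%R <= k + size p)%N.
  by rewrite (leq_trans (size_polyMleq _ _)) // size_polyXn.
have szP (r : 'I_(d + e)) : (size (P r) <= d + e)%N.
  have := ltn_ord r; rewrite /P; case: (ltnP r e) => re rn.
    by rewrite (leq_trans (szX _ _)) //; lia.
  by rewrite (leq_trans (szX _ _)) //; lia.
have -> : rVpoly (u *m sylvester f g d e) = \sum_(r < d + e) (rVpoly u)`_r *: P r.
  rewrite mulmx_sum_row linear_sum; apply: eq_bigr => r _.
  rewrite linearZ /= coef_rVpoly_ord; congr (_ *: _).
  rewrite -[RHS](poly_rV_K (szP r)); congr rVpoly.
  by apply/rowP => l; rewrite !mxE.
rewrite -(big_mkord xpredT (fun r => (rVpoly u)`_r *: P r)).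
rewrite (@big_cat_nat _ _ _ e) //= ?leq_addl //; congr (_ + _).
  rewrite /take_poly poly_def big_mkord mulr_suml; apply: eq_bigr => i _.
  by rewrite /P ltn_ord -scalerAl.
rewrite -{1}[e]add0n big_addn addnK big_mkord.
have -> : drop_poly e (rVpoly u) = \sum_(i < d) (rVpoly u)`_(i + e) *: 'X^i.
  rewrite -(poly_def d (fun i => (rVpoly u)`_(i + e))).
  apply/polyP => i; rewrite coef_drop_poly coef_poly.
  case: ltnP => // di; rewrite nth_default // (leq_trans (size_poly _ _)) //.
  by rewrite leq_add2r.
rewrite mulr_suml; apply: eq_bigr => i _.
by rewrite /P ltnNge leq_addl /= addnK -scalerAl.
Qed.

Lemma sylvester_image (R : comNzRingType) (f g a b : {poly R}) d e :
    (size f <= d.+1)%N -> (size g <= e.+1)%N ->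
    (size a <= e)%N -> (size b <= d)%N ->
  exists u, a * f + b * g = rVpoly (u *m sylvester f g d e).
Proof.
move=> szf szg sza szb; exists (poly_rV (a + 'X^e * b)).
rewrite mul_sylvester // poly_rV_K; last first.
  rewrite (leq_trans (size_polyD _ _)) // geq_max.
  rewrite (leq_trans sza) ?leq_addl //= (leq_trans (size_polyMleq _ _)) //.
  by rewrite size_polyXn /= addnC leq_add2r.
congr (_ * _ + _ * _); apply/polyP => i.
  rewrite coef_take_poly coefD coefXnM; case: ltnP => [_|ie]; first by rewrite addr0.
  by rewrite nth_default // (leq_trans sza).
rewrite coef_drop_poly coefD coefXnM ltnNge leq_addl /= addnK.
by rewrite [a`__]nth_default ?add0r // (leq_trans sza) ?leq_addl.
Qed.

Lemma coef_mul_top (R : comNzRingType) (a f : {poly R}) m d :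
    (size a <= m.+1)%N -> (size f <= d.+1)%N ->
  (a * f)`_(m + d) = a`_m * f`_d.
Proof.
move=> sza szf; rewrite coefM (bigD1 (inord m)) //= inordK ?ltnS ?leq_addr //.
rewrite addKn big1 ?addr0 // => i /eqP im.
have {}im : val i <> m.
  by move=> e; apply: im; apply: val_inj; rewrite /= inordK ?ltnS ?leq_addr.
have [lt|ge] := ltnP m i.
  by rewrite nth_default ?mul0r // (leq_trans sza).
rewrite [f`__]nth_default ?mulr0 // (leq_trans szf) //.
by move: im ge => /= im ge; lia.
Qed.

Variable K : closedFieldType.
Local Notation S := {poly {poly K}}.

(* A Bezout relation in the Laurent polynomials, cleared of denominators. *)
Definition laurent_coprime (p q : {poly K}) :=
  exists u v t, u * p + v * q = 'X^t.

(* The contraction to K[x][y] of the ideal generated by f and g in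
   K[x, 1/x, y, 1/y]. *)
Definition torus_ideal (f g : S) : set S :=
  [set h | exists k l a b, 'X^k *: ('X^l * h) = a * f + b * g].

Lemma torus_ideal_ideal f g : ideal (torus_ideal f g).
Proof.
split.
- by exists 0, 0, 0, 0; rewrite mulr0 scaler0 !mul0r addr0.
- move=> x y [k [l [a [b e1]]]] [k' [l' [a' [b' e2]]]].
  exists (k + k'), (l + l'), ('X^k' *: ('X^l' * a) + 'X^k *: ('X^l * a')),
    ('X^k' *: ('X^l' * b) + 'X^k *: ('X^l * b')).
  have -> : 'X^(k + k') *: ('X^(l + l') * (x + y)) =
    'X^k' *: ('X^l' * ('X^k *: ('X^l * x))) + 'X^k *: ('X^l * ('X^k' *: ('X^l' * y))).
    by rewrite -!mul_polyC !exprD polyCM; move: (_%:P) (_%:P) => *; ring.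
  by rewrite e1 e2 -!mul_polyC; move: (_%:P) (_%:P) => *; ring.
- move=> z x [k [l [a [b e1]]]]; exists k, l, (z * a), (z * b).
  by rewrite mulrCA scalerAr e1; ring.
Qed.

Lemma torus_idealZ f g k h : torus_ideal f g ('X^k *: h) -> torus_ideal f g h.
Proof.
move=> [k' [l [a [b e]]]]; exists (k' + k), l, a, b.
by rewrite -e exprD -scalerA scalerAr.
Qed.

Lemma torus_idealM f g l h : torus_ideal f g ('X^l * h) -> torus_ideal f g h.
Proof.
move=> [k [l' [a [b e]]]]; exists k, (l' + l), a, b.
by rewrite -e exprD -mulrA.
Qed.

Section Descent.
Variables (f g : S) (d e : nat).
Hypotheses (szf : (size f <= d.+1)%N) (szg : (size g <= e.+1)%N).
Hypotheses (top_coprime : laurent_coprime f`_d g`_e)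
  (bottom_coprime : laurent_coprime f`_0 g`_0).

Lemma syzygy_top (p q a b : {poly K}) : laurent_coprime p q ->
  a * p + b * q = 0 -> exists t w, 'X^t * a = w * q /\ 'X^t * b = - (w * p).
Proof.
move=> [u [v [t Bz]]] ab0; exists t, (v * a - u * b); rewrite -Bz; split.
  have -> : (u * p + v * q) * a = u * (a * p + b * q) + (v * a - u * b) * q by ring.
  by rewrite ab0 mulr0 add0r.
have -> : (u * p + v * q) * b = v * (a * p + b * q) - (v * a - u * b) * p by ring.
by rewrite ab0 mulr0 add0r.
Qed.

Lemma size_drop_top (p : S) m : (size p <= m.+1)%N -> p`_m = 0 -> (size p <= m)%N.
Proof.
move=> szp pm; apply/leq_sizeP => j; rewrite leq_eqVlt => /predU1P[<-//|mj].
by rewrite nth_default // (leq_trans szp).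
Qed.

Lemma reduce_degrees l m (w a b : S) k : (size w <= d + e)%N ->
    (size a <= e + l + m)%N -> (size b <= d + l + m)%N ->
    'X^k *: ('X^l * w) = a * f + b * g ->
  exists k' (a' b' : S), [/\ (size a' <= e + l)%N, (size b' <= d + l)%N &
    'X^k' *: ('X^l * w) = a' * f + b' * g].
Proof.
move=> szw; elim: m a b k => [|m IH] a b k; rewrite ?addn0 => sza szb ab.
  by exists k, a, b.
rewrite !addnS in sza szb.
(* The product y^l w has degree below d + e + l, so its coefficient in degree d + e + l + m
   vanishes. *)
have top0 : a`_(e + l + m) * f`_d + b`_(d + l + m) * g`_e = 0.
  rewrite -!coef_mul_top // [(d + l + m + e)%N]addnC !addnA.
  rewrite -[(e + l + m + d)%N]addnC !addnA [(d + e)%N]addnC -coefD -ab coefZ.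
  rewrite nth_default ?mulr0 // (leq_trans (size_polyMleq _ _)) // size_polyXn /=.
  by apply: leq_trans (leq_add (leqnn _) szw) _; lia.
have [t [z [az bz]]] := syzygy_top top_coprime top0.
apply: (IH ('X^t *: a - z *: ('X^(l + m) * g)) ('X^t *: b + z *: ('X^(l + m) * f)) (t + k)).
- apply: size_drop_top.
    rewrite (leq_trans (size_polyD _ _)) // geq_max size_polyN.
    rewrite !(leq_trans (size_scale_leq _ _)) //.
    rewrite (leq_trans (size_polyMleq _ _)) // size_polyXn /=.
    by apply: leq_trans (leq_add (leqnn _) szg) _; lia.
  rewrite coefB !coefZ az coefXnM -addnA [(e + _)%N]addnC.
  by rewrite ltnNge leq_addr /= addKn subrr.
- apply: size_drop_top.
    rewrite (leq_trans (size_polyD _ _)) // geq_max.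
    rewrite !(leq_trans (size_scale_leq _ _)) //.
    rewrite (leq_trans (size_polyMleq _ _)) // size_polyXn /=.
    by apply: leq_trans (leq_add (leqnn _) szf) _; lia.
  rewrite coefD !coefZ bz coefXnM -addnA [(d + _)%N]addnC.
  by rewrite ltnNge leq_addr /= addKn addNr.
- rewrite [in LHS]exprD -scalerA ab -!mul_polyC; move: (_%:P) (_%:P) => *; ring.
Qed.

Lemma mulX_coef0 (p : S) : p`_0 = 0 -> exists q, p = 'X * q.
Proof.
move=> p0; exists (drop_poly 1 p); rewrite -[LHS](poly_take_drop 1) mulrC expr1.
by rewrite (_ : take_poly 1 p = 0) ?add0r //; apply/polyP => -[|i];
   rewrite coef_take_poly ?coef0 ?p0.
Qed.

Lemma reduce_order l (w a b : S) k :
    (size a <= e + l)%N -> (size b <= d + l)%N ->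
    'X^k *: ('X^l * w) = a * f + b * g ->
  exists k' (a' b' : S), [/\ (size a' <= e)%N, (size b' <= d)%N &
    'X^k' *: w = a' * f + b' * g].
Proof.
elim: l a b k => [|l IH] a b k; rewrite ?addn0 => sza szb ab.
  by exists k, a, b; rewrite -ab mul1r.
have bot0 : a`_0 * f`_0 + b`_0 * g`_0 = 0.
  by rewrite -!coef0M -coefD -ab exprS -mulrA coefZ coefXM mulr0.
have [t [z [az bz]]] := syzygy_top bottom_coprime bot0.
have [a' a'E] : exists q, 'X^t *: a - z *: g = 'X * q.
  by apply: mulX_coef0; rewrite coefB !coefZ az subrr.
have [b' b'E] : exists q, 'X^t *: b + z *: f = 'X * q.
  by apply: mulX_coef0; rewrite coefD !coefZ bz addNr.
have szX (p : S) m : (size ('X * p)%R <= m.+1)%N -> (size p <= m)%N.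
  have [->|pN0] := eqVneq p 0; first by rewrite size_poly0.
  by rewrite mulrC size_mulX.
apply: (IH a' b' (t + k)).
- apply: szX; rewrite -a'E (leq_trans (size_polyD _ _)) // geq_max size_polyN.
  rewrite !(leq_trans (size_scale_leq _ _)) // -?addnS //.
  by apply: leq_trans szg _; lia.
- apply: szX; rewrite -b'E (leq_trans (size_polyD _ _)) // geq_max.
  rewrite !(leq_trans (size_scale_leq _ _)) // -?addnS //.
  by apply: leq_trans szf _; lia.
- have XN0 : 'X != 0 :> S by rewrite polyX_eq0.
  apply: (mulfI XN0); rewrite mulrDr !mulrA -a'E -b'E.
  have -> : ('X^t *: a - z *: g) * f + ('X^t *: b + z *: f) * g =
    'X^t *: (a * f + b * g) by rewrite -!mul_polyC; move: (_%:P) (_%:P) => *; ring.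
  by rewrite -ab scalerA -exprD -scalerAr mulrA -exprS.
Qed.

(* The coprimality of the two top (resp. bottom) coefficients makes a relation
   between them a multiple of the Koszul one, which allows to lower the degrees
   of a and b (resp. to divide by y). *)
Lemma torus_ideal_saturation (w : 'rV[{poly K}]_(d + e)) :
  torus_ideal f g (rVpoly w) <-> saturation (sylvester f g d e) w.
Proof.
split=> [[k [l [a [b ab]]]]|[k [u hu]]].
  have szw : (size (rVpoly w) <= d + e)%N by rewrite size_poly.
  pose m := (size a + size b)%N.
  have [||k1 [a1 [b1 [sza1 szb1 ab1]]]] := reduce_degrees (m := m) szw _ _ ab.
  - by rewrite /m; lia.
  - by rewrite /m; lia.
  have [k2 [a2 [b2 [sza2 szb2 ab2]]]] := reduce_order sza1 szb1 ab1.
  have [u ue] := sylvester_image szf szg sza2 szb2.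
  by exists k2, u; apply: (can_inj rVpolyK); rewrite linearZ /= ab2.
exists k, 0%N, (take_poly e (rVpoly u)), (drop_poly e (rVpoly u)).
by rewrite mul1r -mul_sylvester // -hu linearZ.
Qed.

(** The Bezout relation between the top coefficients provides combinations of f and g with leading
    coefficient x^t, by which x^t h can be divided until its degree is below d + e. The factor x^t
    is then removed because it acts bijectively on the finite-dimensional quotient of the row
    vectors. *)
Lemma torus_ideal_generated (h : S) N :
    codim (saturation (sylvester f g d e)) N ->
  exists w : 'rV_(d + e), torus_ideal f g (h - rVpoly w).
Proof.
move=> cN; have sN := saturation_subspace (sylvester f g d e).
have [J0 JD JM] := torus_ideal_ideal f g.
have surj t (w : 'rV_(d + e)) : exists w', saturation (sylvester f g d e) (w - 'X^t *: w').
  apply: (codim_surj (phi := fun w => 'X^t *: w) sN cN).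
    by move=> a x y; rewrite scalerDr !scalerA mulrC.
  move=> x; rewrite -!torus_ideal_saturation linearZ /=; split.
    exact: torus_idealZ.
  by rewrite -mul_polyC; apply: JM.
have [m] := ubnP (size h); elim: m h => // m IH h; rewrite ltnS => szh.
have [small|large] := leqP (size h) (d + e).
  by exists (poly_rV h); rewrite poly_rV_K // subrr.
have [u [v [t Bz]]] := top_coprime.
pose s := (size h).-1; pose c := h`_s.
pose r := (c * u) *: 'X^(s - d) * f + (c * v) *: 'X^(s - e) * g.
have Jr : torus_ideal f g r.
  by exists 0%N, 0%N, ((c * u) *: 'X^(s - d)), ((c * v) *: 'X^(s - e)); rewrite scale1r mul1r.
have szs : size h = s.+1 by rewrite /s prednK //; lia.
have szr (q : {poly K}) (p : S) k : (size p <= k.+1)%N -> (k <= s)%N ->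
    (size (q *: 'X^(s - k) * p)%R <= s.+1)%N.
  move=> szp ks; rewrite -scalerAl (leq_trans (size_scale_leq _ _)) //.
  rewrite (leq_trans (size_polyMleq _ _)) // size_polyXn /=.
  by apply: leq_trans (leq_add (leqnn _) szp) _; lia.
have hr : (size ('X^t *: h - r)%R < m)%N.
  rewrite (leq_trans _ szh) // szs ltnS; apply: size_drop_top.
    rewrite (leq_trans (size_polyD _ _)) // geq_max size_polyN -{1}szs size_scale_leq.
    rewrite (leq_trans (size_polyD _ _)) // geq_max.
    by rewrite !szr //; lia.
  rewrite coefB coefD -!scalerAl !coefZ !coefXnM !ltnNge !leq_subr /=.
  by rewrite !subKn; [rewrite -Bz -/c; ring|lia|lia].
have [w0 Jw0] := IH _ hr.
have [w Jw] := surj t w0.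
exists w; apply: (@torus_idealZ _ _ t).
move/torus_ideal_saturation: Jw; rewrite linearB linearZ /= => Jw.
have := JD _ _ Jr (JD _ _ Jw0 Jw).
congr torus_ideal; rewrite scalerBr.
by move: (_ *: _) (_ *: _) => x y; ring.
Qed.

Lemma torus_ideal_codim N : codim (saturation (sylvester f g d e)) N ->
  codim (torus_ideal f g) N.
Proof.
move=> cN; have [E hE] := cN; exists (fun i => rVpoly (E i)) => z.
have sJ := ideal_subspace (torus_ideal_ideal f g).
have [w Jw] := torus_ideal_generated z cN.
have sumE (c : 'rV[K]_N) : z - \sum_i (c 0 i)%:P *: rVpoly (E i) =
    (z - rVpoly w) + rVpoly (w - \sum_i (c 0 i)%:P *: E i).
  rewrite linearB /= addrA subrK [in RHS]linear_sum; congr (z - _).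
  by apply: eq_bigr => i _; rewrite linearZ.
have [c [Jc cU]] := hE w; exists c; split=> [|c' Jc'].
  by rewrite sumE; apply: subspaceD => //; apply/torus_ideal_saturation.
apply: cU; apply/torus_ideal_saturation.
have := subspaceB sJ Jc' Jw; rewrite sumE; congr torus_ideal.
by rewrite addrC addKr.
Qed.

End Descent.
End Sylvester.

(** * Merging two convex sequences *)

Section Merge.
Variables (R : realFieldType) (d e : nat) (p q : nat -> R).

Definition slope (r : nat -> R) i : R := r i.+1 - r i.

Definition convex_seq (r : nat -> R) n :=
  forall i, (i.+2 <= n)%N -> slope r i <= slope r i.+1.

Definition corner (r : nat -> R) n i :=
  [|| i == 0%N, i == n | slope r i.-1 < slope r i].

(* The unit steps of the two convex sequences are merged by increasing slope,
   those of p first in case of a tie. *)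
Definition p_first (ij : nat * nat) :=
  (ij.1 < d)%N && ((e <= ij.2)%N || (slope p ij.1 <= slope q ij.2)).

Definition merge k : nat * nat :=
  iter k (fun ij => if p_first ij then (ij.1.+1, ij.2) else (ij.1, ij.2.+1)) (0%N, 0%N).

Definition merge_val k : R := p (merge k).1 + q (merge k).2.

(** The height at which column k meets the row assigned to step k: a step of p reads the current
    point of q, and conversely. *)
Definition diag_val k : R :=
  if p_first (merge k) then q (merge k).2 else p (merge k).1.

Lemma mergeS k : merge k.+1 =
  if p_first (merge k) then ((merge k).1.+1, (merge k).2)
  else ((merge k).1, (merge k).2.+1).
Proof. by []. Qed.

Lemma merge_sum k : ((merge k).1 + (merge k).2 = k)%N.
Proof. by elim: k => // k IH; rewrite mergeS; case: ifP => _ /=; lia. Qed.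

Lemma merge_le k : (k <= d + e)%N -> ((merge k).1 <= d)%N /\ ((merge k).2 <= e)%N.
Proof.
elim: k => // k IH kn; have [i1 j1] := IH (ltnW kn).
have ks := merge_sum k; rewrite mergeS /p_first.
case: (ltnP (merge k).1 d) => /= h1; last by lia.
case: (leqP e (merge k).2) => /= h2; first by lia.
by case: ifP => _ /=; lia.
Qed.

Lemma p_first_lt k : (k < d + e)%N ->
  if p_first (merge k) then ((merge k).1 < d)%N else ((merge k).2 < e)%N.
Proof.
move=> kn; have [] := merge_le kn.
by rewrite mergeS; case: ifP => _ /=.
Qed.

Lemma merge_end : merge (d + e) = (d, e).
Proof.
have [] := merge_le (leqnn (d + e)); have := merge_sum (d + e).
case: (merge _) => i j /= *; congr pair; lia.
Qed.

Lemma merge_mono k l : (k <= l)%N ->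
  ((merge k).1 <= (merge l).1)%N /\ ((merge k).2 <= (merge l).2)%N.
Proof.
move=> /subnKC <-; elim: (l - k)%N => [|m [IH1 IH2]]; first by rewrite addn0.
by rewrite addnS mergeS; case: ifP => _ /=; split=> //; apply: leqW.
Qed.

Hypotheses (cp : convex_seq p d) (cq : convex_seq q e).

Lemma convex_slope_le r n i j : convex_seq r n -> (i <= j)%N -> (j < n)%N ->
  slope r i <= slope r j.
Proof.
move=> cr /subnKC <-; elim: (j - i)%N => [|m IH]; rewrite ?addn0 // addnS => h.
by apply: le_trans (cr _ h); apply: IH; lia.
Qed.

Lemma convex_ge r n i m : convex_seq r n -> (i + m <= n)%N -> (0 < m)%N ->
  m%:R * slope r i <= r (i + m)%N - r i.
Proof.
move=> cr; elim: m => // -[_ h _|m IH h _]; first by rewrite addn1 mul1r.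
have h1 : (i + m.+1 < n)%N by rewrite -addnS.
have := convex_slope_le cr (leq_addr m.+1 i) h1.
have := IH (ltnW h1) isT.
by rewrite (addnS i m.+1) -(natr1 m.+1) mulrDl mul1r {3}/slope; lra.
Qed.

Lemma convex_le r n i m : convex_seq r n -> (i + m <= n)%N -> (0 < m)%N ->
  r (i + m)%N - r i <= m%:R * slope r (i + m).-1.
Proof.
move=> cr; elim: m => // -[_ h _|m IH h _]; first by rewrite addn1 mul1r.
have h1 : (i + m.+1 < n)%N by rewrite -addnS.
have := IH (ltnW h1) isT.
have : slope r (i + m) <= slope r (i + m).+1 by apply: cr; rewrite -!addnS.
rewrite (addnS i m.+1) -(natr1 m.+1) mulrDl mul1r addnS /= => s1 h2.
have : m.+1%:R * slope r (i + m) <= m.+1%:R * slope r (i + m).+1.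
  exact: ler_wpM2l.
by rewrite {4}/slope; lra.
Qed.

(** The greedy invariant: the last slope used in one sequence does not exceed the next slope of the
    other. Ties go to p, which makes the second inequality strict. *)
Lemma merge_slopes k : (k <= d + e)%N ->
  ((0 < (merge k).1)%N -> ((merge k).2 < e)%N ->
     slope p (merge k).1.-1 <= slope q (merge k).2) /\
  ((0 < (merge k).2)%N -> ((merge k).1 < d)%N ->
     slope q (merge k).2.-1 < slope p (merge k).1).
Proof.
elim: k => // k IH kn; have [h1 h2] := IH (ltnW kn).
have := p_first_lt kn; rewrite mergeS; case: ifP => /= [/andP[id pq] _|npf je].
  split=> [_ je|j0 id2]; first by move: pq; rewrite leqNgt je.
  by apply: lt_le_trans (h2 j0 id) _; apply: cp.
move: npf; rewrite /p_first [(e <= _)%N]leqNgt je /= => npf; split=> [i0 je2|_ id].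
  by apply: le_trans (h1 i0 je) _; apply: cq.
by move: npf; rewrite id /= => /negbT; rewrite -real_ltNge ?num_real.
Qed.

(* merge_val is the infimal convolution of p and q, and (merge k).1 is the
   largest minimizer. *)
Lemma merge_val_le i j : (i <= d)%N -> (j <= e)%N ->
  merge_val (i + j) <= p i + q j /\
  (merge_val (i + j) = p i + q j -> (i <= (merge (i + j)).1)%N).
Proof.
move=> id je; have kn : (i + j <= d + e)%N by lia.
have [h1 h2] := merge_slopes kn; have ks := merge_sum (i + j).
have [I1 J1] := merge_le kn; rewrite /merge_val.
move: (merge _).1 (merge _).2 ks h1 h2 I1 J1 => I J ks h1 h2 I1 J1.
have [lt|ge] := ltnP I i.
  pose m := (i - I)%N; have iE : i = (I + m)%N by rewrite /m; lia.
  have JE : J = (j + m)%N by lia.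
  have Hm : (0 < m)%N by lia.
have Hn : (I + m <= d)%N by lia.
have := convex_ge cp Hn Hm.
  clear Hn Hm; rewrite -iE.
  have Hm : (0 < m)%N by lia.
have Hn : (j + m <= e)%N by lia.
have := convex_le cq Hn Hm.
  clear Hn Hm; rewrite -JE => hq hp.
  have lt2 : m%:R * slope q J.-1 < m%:R * slope p I.
    by rewrite ltr_pM2l ?ltr0n; [apply: h2|]; lia.
  have H : p I + q J < p i + q j by move: hp hq lt2; lra.
  by split=> [|E]; [exact: ltW|rewrite E ltxx in H].
split=> //; have [ei|ne] := eqVneq i I; first by rewrite ei (_ : j = J) //; lia.
pose m := (I - i)%N; have iE : I = (i + m)%N by rewrite /m; lia.
have jE : j = (J + m)%N by lia.
have Hm : (0 < m)%N by lia.
have Hn : (J + m <= e)%N by lia.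
have := convex_ge cq Hn Hm.
clear Hn Hm; rewrite -jE.
have Hm : (0 < m)%N by lia.
have Hn : (i + m <= d)%N by lia.
have := convex_le cp Hn Hm.
clear Hn Hm; rewrite -iE => hp hq.
have le2 : m%:R * slope p I.-1 <= m%:R * slope q J.
  by rewrite ler_pM2l ?ltr0n; [apply: h1|]; lia.
by move: hp hq le2; lra.
Qed.

Lemma merge_val_convex : convex_seq merge_val (d + e).
Proof.
move=> k kn; have k1 : (k < d + e)%N by lia.
have := p_first_lt kn; have := p_first_lt k1.
have := merge_slopes (ltnW kn); rewrite /slope /merge_val (mergeS k.+1) (mergeS k).
have [le1 le2] := merge_le (ltnW kn); move: le1 le2; rewrite mergeS.
case: (boolP (p_first (merge k))) => pf1 /=; case: ifP => pf2 /= le1 le2 [h1 h2] l1 l2.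
- by have := cp (l2 : ((merge k).1.+2 <= d)%N); rewrite /slope; lra.
- by have := h1 isT l2; rewrite /slope; lra.
- by have := h2 isT l2; rewrite /slope; lra.
- by have := cq (l2 : ((merge k).2.+2 <= e)%N); rewrite /slope; lra.
Qed.

(** When p moves from inside the range of q, the last slope of q is strictly below that of p, which
    is at most the next slope of q; so q turns there. The other case is symmetric, with the strict
    inequality coming from the refusal of p. *)
Lemma corner_merge k : (k < d + e)%N ->
  if p_first (merge k) then corner q e (merge k).2 else corner p d (merge k).1.
Proof.
move=> kn; have := p_first_lt kn; have [h1 h2] := merge_slopes (ltnW kn).
have [I1 J1] := merge_le (ltnW kn); rewrite /corner.
case: ifP => pf lt.
  have [//|j0] := eqVneq (merge k).2 0%N; have [//|je] := eqVneq (merge k).2 e.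
  have {}je : ((merge k).2 < e)%N by rewrite ltn_neqAle je.
  move: pf; rewrite /p_first lt leqNgt je /= => pf.
  by apply: lt_le_trans (h2 _ lt) pf; rewrite lt0n.
have [//|i0] := eqVneq (merge k).1 0%N; have [//|id] := eqVneq (merge k).1 d.
have {}id : ((merge k).1 < d)%N by rewrite ltn_neqAle id.
move: pf; rewrite /p_first id leqNgt lt /= => /negbT; rewrite -ltNge.
by apply: le_lt_trans; apply: h1; rewrite ?lt0n.
Qed.

Definition trapezoids (r : nat -> R) n : R := \sum_(k < n) (r k + r k.+1) / 2.

(** A step of p, raised by the current value of q, has the trapezoid of p plus exactly that value,
    and conversely. *)
Lemma trapezoids_merge : trapezoids merge_val (d + e) =
  \sum_(k < d + e) diag_val k + trapezoids p d + trapezoids q e.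
Proof.
rewrite -[d in trapezoids p d]/(d, e).1 -[e in trapezoids q e]/(d, e).2 -merge_end.
elim: (d + e)%N => [|k IH]; first by rewrite /trapezoids !big_ord0 !addr0.
rewrite {1}/trapezoids !big_ord_recr /= -/(trapezoids _ k) IH /diag_val.
rewrite /merge_val mergeS; case: ifP => _ /=;
  rewrite /trapezoids big_ord_recr /=; lra.
Qed.

End Merge.

(** * Order of a Sylvester determinant *)

Lemma eq_leq_sum (I : finType) (F G : I -> nat) :
    (forall i, F i <= G i)%N -> (\sum_i F i = \sum_i G i)%N ->
  forall i, F i = G i.
Proof.
move=> FG E i; have FGi j : (F j <= G j ?= iff (F j == G j))%N.
  by split.
have [_] := leqif_sum (fun j (_ : true) => FGi j).
by rewrite E eqxx => /esym/forallP/(_ i)/eqP.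
Qed.

Lemma eq_ler_sum (R : realFieldType) (I : finType) (F G : I -> R) :
    (forall i, F i <= G i) -> \sum_i F i = \sum_i G i ->
  forall i, F i = G i.
Proof.
move=> FG E i; have h0 : forall j, true -> 0 <= G j - F j.
  by move=> j _; rewrite subr_ge0.
have s0 : \sum_j (G j - F j) = 0 by rewrite sumrB E subrr.
by have /eqP := psumr_eq0P h0 s0 (i := i) isT; rewrite subr_eq0 => /eqP.
Qed.

Lemma perm_le_id n (s : 'S_n) : (forall k, s k <= k)%N -> s = 1%g.
Proof.
move=> h; apply/permP => k; rewrite perm1; apply: val_inj.
apply: (eq_leq_sum (F := fun k => val (s k)) (G := fun k => val k) h).
by rewrite [RHS](reindex_inj (@perm_inj _ s)).
Qed.

Lemma det_injective_rows (R : comNzRingType) n (A : 'M[R]_n) (r : 'I_n -> 'I_n) :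
    injective r ->
  exists b : bool, \det A = (-1) ^+ b * \det (\matrix_(k, l) A (r k) l).
Proof.
move=> inj; exists (odd_perm (perm inj)).
have -> : \matrix_(k, l) A (r k) l = row_perm (perm inj) A.
  by apply/matrixP => k l; rewrite !mxE permE.
by rewrite row_permE det_mulmx det_perm mulrA -expr2 sqrr_sign mul1r.
Qed.

(** * Lower bounds for the order of a polynomial at 0 or at infinity *)

Section Valuation.
Variables (R : realFieldType) (F : nzRingType) (sg : R).

(* For sg = 1 (resp. -1) a lower bound w on the order at 0 (resp. at infinity). *)
Definition order_ge w (P : {poly F}) := forall h, P`_h != 0 -> w <= sg * h%:R.

Lemma order_ge_le w w' P : w' <= w -> order_ge w P -> order_ge w' P.
Proof. by move=> ww h i /h; apply: le_trans. Qed.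

Lemma order_ge0 w : order_ge w 0.
Proof. by move=> h; rewrite coef0 eqxx. Qed.

Lemma order_geM w w' P Q : order_ge w P -> order_ge w' Q ->
  order_ge (w + w') (P * Q).
Proof.
move=> hP hQ h; rewrite coefM => nz.
have [i] : exists i : 'I_h.+1, P`_i * Q`_(h - i) != 0.
  apply/existsP; apply: contraR nz; rewrite negb_exists => /forallP h0.
  by rewrite big1 // => i _; apply/eqP; have := h0 i; rewrite negbK.
move=> PQ; have Pi : P`_i != 0 by apply: contraNneq PQ => ->; rewrite mul0r.
have Qi : Q`_(h - i) != 0 by apply: contraNneq PQ => ->; rewrite mulr0.
have ih : (i <= h)%N by rewrite -ltnS.
rewrite -(subnKC ih) natrD mulrDr; apply: lerD; [exact: hP | exact: hQ].
Qed.

Lemma order_geD w P Q : order_ge w P -> order_ge w Q -> order_ge w (P + Q).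
Proof.
move=> hP hQ h; rewrite coefD; have [->|/hP//] := eqVneq P`_h 0.
by rewrite add0r => /hQ.
Qed.

Lemma order_ge_sum w I (r : seq I) (G : I -> {poly F}) :
  (forall i, order_ge w (G i)) -> order_ge w (\sum_(i <- r) G i).
Proof.
move=> h; elim/big_ind: _ => //; first exact: order_ge0.
by move=> *; apply: order_geD.
Qed.

Lemma order_ge1 : order_ge 0 1.
Proof.
move=> h; rewrite coef1; have [->|] := eqVneq h 0%N; last by rewrite eqxx.
by rewrite mulr0.
Qed.

Lemma order_ge_prod I (r : seq I) (w : I -> R) (G : I -> {poly F}) :
  (forall i, order_ge (w i) (G i)) ->
  order_ge (\sum_(i <- r) w i) (\prod_(i <- r) G i).
Proof.
move=> h; elim/big_ind2: _ => //; first exact: order_ge1.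
by move=> *; apply: order_geM.
Qed.

Lemma order_ge_sign w (b : nat) P : order_ge w P -> order_ge w ((-1) ^+ b * P).
Proof.
move=> hP h; rewrite -signr_odd; case: odd; last by rewrite mul1r => /hP.
by rewrite expr1 mulN1r coefN oppr_eq0 => /hP.
Qed.

End Valuation.

(** * The minimal transversal of the Sylvester matrix *)

Section SylvesterValuation.
Variables (R : realFieldType) (sg : R) (d e : nat) (p q : nat -> R).
Hypotheses (cp : convex_seq p d) (cq : convex_seq q e).
Local Notation M := (merge d e p q).
Local Notation pf k := (p_first d e p q (M k)).
Local Notation psi := (merge_val d e p q).
Local Notation diag := (diag_val d e p q).

(** The row matched with column k: y^i g for a step of p, stored after the e multiples of f, and y^j
    f for a step of q. *)
Definition merge_row k := if pf k then (e + (M k).1)%N else (M k).2.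

Lemma merge_row_lt (k : 'I_(d + e)) : (merge_row k < d + e)%N.
Proof.
have := p_first_lt p q (ltn_ord k); rewrite /merge_row; case: ifP => _; lia.
Qed.

Definition merge_ord k : 'I_(d + e) := Ordinal (merge_row_lt k).

Lemma merge_step_lt k l : (k < l)%N ->
  if pf k then ((M k).1 < (M l).1)%N else ((M k).2 < (M l).2)%N.
Proof.
move=> kl; have [] := merge_mono d e p q kl; rewrite mergeS.
by case: ifP.
Qed.

Lemma merge_ord_inj : injective merge_ord.
Proof.
move=> k l /(congr1 val) /=; rewrite /merge_row => E; apply: val_inj => /=.
have := p_first_lt p q (ltn_ord k); have := p_first_lt p q (ltn_ord l).
have := @merge_step_lt k l; have := @merge_step_lt l k.
move: E; case: (boolP (pf k)) => _; case: (boolP (pf l)) => _;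
  case: (ltngtP k l) => // _ E h1 h2; try (by move=> *; lia);
  try have := h1 isT; try have := h2 isT; lia.
Qed.

Definition merge_entry (F : comNzRingType) (f g : {poly F}) k l :=
  if pf k then ('X^((M k).1) * g)`_l else ('X^((M k).2) * f)`_l.

Lemma det_sylvester_merge (F : comNzRingType) (f g : {poly F}) :
  exists b : bool, \det (sylvester f g d e) =
    (-1) ^+ b * \sum_(s : 'S_(d + e)) (-1) ^+ s * \prod_(k < d + e) merge_entry f g k (s k).
Proof.
have [b ->] := det_injective_rows (sylvester f g d e) merge_ord_inj.
exists b; congr (_ * _); apply: eq_bigr => s _; congr (_ * _).
apply: eq_bigr => k _; rewrite !mxE /= /merge_row /merge_entry.
have := p_first_lt p q (ltn_ord k).
by case: ifP => _ lt; rewrite ?lt // ltnNge leq_addr /= addKn.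
Qed.

(** The potential [psi] cancels along any permutation. The summand will be a lower bound for the
    order of entry (k, s k), so all transversals share the same bound. *)
Lemma sum_diag_perm (s : 'S_(d + e)) :
  \sum_(k < d + e) (diag k + psi (s k) - psi k) = \sum_(k < d + e) diag k.
Proof.
rewrite sumrB big_split /=.
by rewrite [X in _ - X](reindex_inj (@perm_inj _ s)) /= addrK.
Qed.

(** In column l the row y^i g has entry g_(l-i), of order at least q (l - i) >= psi l - p i = diag k
    + psi l - psi k by infimal convolution; the rows of f are similar. *)
Lemma det_sylvester_order (F : comNzRingType) (f g : {poly {poly F}}) :
    (size f <= d.+1)%N -> (size g <= e.+1)%N ->
    (forall i, (i <= d)%N -> order_ge sg (p i) f`_i) ->
    (forall j, (j <= e)%N -> order_ge sg (q j) g`_j) ->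
  order_ge sg (\sum_(k < d + e) diag k) (\det (sylvester f g d e)).
Proof.
move=> szf szg hf hg; have [b ->] := det_sylvester_merge f g.
apply: order_ge_sign; apply: order_ge_sum => s; apply: order_ge_sign.
rewrite -(sum_diag_perm s); apply: order_ge_prod => k.
move: (s k) => l; rewrite /merge_entry /diag_val /merge_val.
have := p_first_lt p q (ltn_ord k); have [I1 J1] := merge_le p q (ltnW (ltn_ord k)).
case: ifP => _ lt; rewrite coefXnM; case: ltnP => kl; try exact: order_ge0.
  have [big|small] := ltnP e (l - (M k).1).
    by rewrite nth_default ?(leq_trans szg) //; exact: order_ge0.
  apply: order_ge_le (hg _ small).
  have [+ _] := merge_val_le cp cq I1 small; rewrite subnKC // /merge_val; lra.
have [big|small] := ltnP d (l - (M k).2).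
  by rewrite nth_default ?(leq_trans szf) //; exact: order_ge0.
apply: order_ge_le (hf _ small).
have [+ _] := merge_val_le cp cq small J1; rewrite subnK // /merge_val; lra.
Qed.

Variables hp hq : nat -> nat.
Hypotheses
  (hpE : forall i, (i <= d)%N -> corner p d i -> p i = sg * (hp i)%:R)
  (hqE : forall j, (j <= e)%N -> corner q e j -> q j = sg * (hq j)%:R).

Definition diag_exp k := if pf k then hq (M k).2 else hp (M k).1.

Lemma diag_expE (k : 'I_(d + e)) : diag k = sg * (diag_exp k)%:R.
Proof.
have := corner_merge cp cq (ltn_ord k); rewrite /diag_val /diag_exp.
by have [I1 J1] := merge_le p q (ltnW (ltn_ord k)); case: ifP => _;
  [exact: hqE | exact: hpE].
Qed.

(* The powers of t break the ties between edges of equal slope, for which the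
   extreme coefficient of the determinant would be a resultant of edge
   polynomials. *)
Definition corner_poly (F : nzRingType) (r : nat -> R) n (h : nat -> nat) (t : F) :
    {poly {poly F}} :=
  \poly_(i < n.+1) (if corner r n i then (t ^+ i)%:P * 'X^(h i) else 0 : {poly F}).

(** For the corner polynomials, entry (k, l) is zero or a monomial in t and x; [nz], [x_exp] and
    [t_exp] record which. Only g carries t, hence the exponent 0 on the rows of f. *)
Let nz k l := if pf k then
    [&& ((M k).1 <= l)%N, (l - (M k).1 <= e)%N & corner q e (l - (M k).1)%N]
  else [&& ((M k).2 <= l)%N, (l - (M k).2 <= d)%N & corner p d (l - (M k).2)%N].

Let x_exp k l := if pf k then hq (l - (M k).1)%N else hp (l - (M k).2)%N.

Let t_exp k l := if pf k then (l - (M k).1)%N else 0%N.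

Lemma merge_entry_corner (F : fieldType) k l :
  merge_entry (corner_poly p d hp 1) (corner_poly q e hq ('X : {poly F})) k l =
  if nz k l then ('X^(t_exp k l))%:P * 'X^(x_exp k l) else 0.
Proof.
rewrite /merge_entry /nz /t_exp /x_exp; case: ifP => _; rewrite coefXnM.
  case: leqP => //= _; rewrite coef_poly ltnS.
  by case: leqP.
case: leqP => //= _; rewrite coef_poly ltnS.
by case: leqP => //= _; rewrite expr1n expr0.
Qed.

Lemma nz_diag (k : 'I_(d + e)) : nz k k.
Proof.
have := corner_merge cp cq (ltn_ord k).
have [I1 J1] := merge_le p q (ltnW (ltn_ord k)); have := merge_sum d e p q k.
move=> ks; have E1 : (k - (M k).1 = (M k).2)%N by lia.
have E2 : (k - (M k).2 = (M k).1)%N by lia.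
rewrite /nz; case: ifP => _ c; rewrite ?E1 ?E2 c ?I1 ?J1; lia.
Qed.

(** Equality means that entry (k, l) splits l into a minimizer of the infimal convolution. As the
    merge has the largest minimizing index in p, its index in q is the smallest. *)
Lemma x_exp_ge (k l : 'I_(d + e)) : nz k l ->
  diag k + psi l - psi k <= sg * (x_exp k l)%:R /\
  (diag k + psi l - psi k = sg * (x_exp k l)%:R ->
   ((M l).2 <= if pf k then l - (M k).1 else (M k).2)%N).
Proof.
have ls := merge_sum d e p q l.
have [I1 J1] := merge_le p q (ltnW (ltn_ord k)).
rewrite /nz /x_exp /diag_val /merge_val; case: ifP => _ /and3P[kl le c].
  rewrite -(hqE le c); have := merge_val_le cp cq I1 le.
  rewrite subnKC // /merge_val => -[h1 h2]; split=> [|E]; first by lra.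
  by have := h2 ltac:(lra); lia.
rewrite -(hpE le c); have := merge_val_le cp cq le J1.
rewrite subnK // /merge_val => -[h1 h2]; split=> [|E]; first by lra.
by have := h2 ltac:(lra); lia.
Qed.

Let a := (\sum_(k < d + e) x_exp k k)%N.
Let b := (\sum_(k < d + e) t_exp k k)%N.

Lemma sum_diag_exp : \sum_(k < d + e) diag k = sg * a%:R.
Proof.
rewrite natr_sum mulr_sumr; apply: eq_bigr => k _; rewrite diag_expE /diag_exp.
have ks := merge_sum d e p q k; rewrite /x_exp.
by case: ifP => _; rewrite -{2}ks ?addKn ?addnK.
Qed.

(* The diagonal is the only transversal of the row-permuted Sylvester matrix
   that is minimal for the lexicographic order on the exponents of x and t. *)
Lemma minimal_perm (s : 'S_(d + e)) :
    (forall k : 'I_(d + e), nz k (s k)) ->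
    (\sum_(k < d + e) x_exp k (s k) = a)%N ->
    (\sum_(k < d + e) t_exp k (s k) = b)%N ->
  s = 1%g.
Proof.
move=> hnz hx ht.
(* Both sides have the same sum, so every termwise bound is an equality. *)
have eqx : forall k : 'I_(d + e),
    diag k + psi (s k) - psi k = sg * (x_exp k (s k))%:R.
  apply: eq_ler_sum => [k|]; first by have [] := x_exp_ge (hnz k).
  by rewrite sum_diag_perm sum_diag_exp -hx natr_sum mulr_sumr.
pose G (k l : 'I_(d + e)) := if pf k then (l - (M k).1)%N else (M k).2.
have leJ k : ((M (s k)).2 <= G k (s k))%N.
  by have [_ /(_ (eqx k))] := x_exp_ge (hnz k).
(* Summed over k, the left side does not depend on s, and the right side depends on it only through
   the exponents of t, whose total is b as on the diagonal. *)
have eqJ : forall k, (M (s k)).2 = G k (s k).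
  apply: eq_leq_sum leJ _.
  have GE k l : G k l = (t_exp k l + if pf k then 0 else (M k).2)%N.
    by rewrite /G /t_exp; case: ifP => _; rewrite ?addn0.
  under [RHS]eq_bigr do rewrite GE.
  rewrite big_split /= ht /b -big_split /=.
  rewrite [LHS](reindex_inj (@perm_inj _ s^-1)) /=.
  apply: eq_bigr => k _; rewrite permKV -GE /G.
  have ks := merge_sum d e p q k.
  by case: ifP => _ //; rewrite -{2}ks addKn.
(* By [eqJ] the merge at s k has the same index as at k in the sequence that moves at step k, which
   is impossible if s k > k. *)
apply: perm_le_id => k; rewrite leqNgt; apply/negP => lt.
have := eqJ k; rewrite /G; have := merge_step_lt lt.
have := merge_sum d e p q (s k); case: ifP => _; lia.
Qed.

Lemma det_corner_coef (F : fieldType) : exists c : bool,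
  ((\det (sylvester (corner_poly p d hp 1)
            (corner_poly q e hq ('X : {poly F})) d e))`_a)`_b = (-1) ^+ c.
Proof.
pose term (s : 'S_(d + e)) : {poly {poly F}} :=
  if [forall k : 'I_(d + e), nz k (s k)] then
    ('X^(\sum_(k < d + e) t_exp k (s k)))%:P * 'X^(\sum_(k < d + e) x_exp k (s k))
  else 0.
have termE (s : 'S_(d + e)) : \prod_(k < d + e) merge_entry
    (corner_poly p d hp 1) (corner_poly q e hq ('X : {poly F})) k (s k) = term s.
  rewrite /term; case: ifP => [/forallP h|/negbT].
    under eq_bigr do rewrite merge_entry_corner h.
    by rewrite big_split /= -rmorph_prod !prodrXr.
  rewrite negb_forall => /existsP[k nk]; rewrite (bigD1 k) //=.
  by rewrite merge_entry_corner (negPf nk) mul0r.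
have signE (c : bool) (P : {poly {poly F}}) :
    (((-1) ^+ c * P)`_a)`_b = (-1) ^+ c * (P`_a)`_b.
  by case: c; rewrite ?expr0 ?mul1r // !expr1 !mulN1r !coefN.
pose T := \sum_(s : 'S_(d + e)) (-1) ^+ s * term s.
suff T1 : (T`_a)`_b = 1.
  have [c hc] := det_sylvester_merge (corner_poly p d hp 1)
    (corner_poly q e hq ('X : {poly F})).
  exists c; transitivity ((((-1) ^+ c * T)`_a)`_b); last by rewrite signE T1 mulr1.
  rewrite hc; congr ((polyseq (polyseq (_ * _))`__)`__).
  by apply: eq_bigr => s _; congr (_ * _); exact: termE.
rewrite /T !coef_sum (bigD1 1%g) // big1.
  rewrite signE odd_perm1 expr0 mul1r /term.
  have -> : [forall k : 'I_(d + e), nz k ((1%g : 'S_(d + e)) k)].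
    by apply/forallP => k; rewrite perm1; exact: nz_diag.
  have -> : (\sum_(k < d + e) t_exp k ((1%g : 'S_(d + e)) k) = b)%N.
    by apply: eq_bigr => k _; rewrite perm1.
  have -> : (\sum_(k < d + e) x_exp k ((1%g : 'S_(d + e)) k) = a)%N.
    by apply: eq_bigr => k _; rewrite perm1.
  by rewrite coefCM coefXn eqxx mulr1 coefXn eqxx; exact: addr0.
move=> s s1; rewrite signE /term.
case: ifP => [/forallP h|_]; last by rewrite !coef0 mulr0.
rewrite coefCM coefXn; case: eqP => [Ea|_]; last by rewrite mulr0 coef0 mulr0.
rewrite mulr1 coefXn; case: eqP => [Eb|_]; last by rewrite mulr0.
by case/eqP: s1; apply: minimal_perm.
Qed.

End SylvesterValuation.

Lemma map_sylvester (F G : comNzRingType) (phi : {rmorphism F -> G})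
    (f g : {poly F}) d e :
  map_mx phi (sylvester f g d e) = sylvester (map_poly phi f) (map_poly phi g) d e.
Proof.
apply/matrixP => r l; rewrite !mxE.
by case: ifP => _; rewrite !coefXnM coef_map; case: ifP => _; rewrite ?rmorph0.
Qed.

Lemma map_corner_poly (R : realFieldType) (F G : comNzRingType)
    (phi : {rmorphism F -> G}) (r : nat -> R) n h t :
  map_poly (map_poly phi) (corner_poly r n h t) = corner_poly r n h (phi t).
Proof.
apply/polyP => i; rewrite coef_map !coef_poly.
case: ltnP => _; last by rewrite /= rmorph0.
case: ifP => _; last by rewrite /= rmorph0.
by rewrite /= rmorphM /= map_polyC /= rmorphXn /= map_polyXn.
Qed.


(** The coefficient of x^a is a polynomial in t, nonzero because one of its coefficients is a sign;
    some value of t in K is not a root. *)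
Lemma det_corner_witness (K : closedFieldType) (R : realFieldType) (sg : R) d e
    (p q : nat -> R) (hp hq : nat -> nat) :
    convex_seq p d -> convex_seq q e ->
    (forall i, (i <= d)%N -> corner p d i -> p i = sg * (hp i)%:R) ->
    (forall j, (j <= e)%N -> corner q e j -> q j = sg * (hq j)%:R) ->
  exists a (t : K), \sum_(k < d + e) diag_val d e p q k = sg * a%:R /\
    (\det (sylvester (corner_poly p d hp 1) (corner_poly q e hq t) d e))`_a != 0.
Proof.
move=> cp cq hpE hqE; have sumE := sum_diag_exp cp cq hpE hqE.
have [c] := det_corner_coef cp cq hpE hqE K.
set D := \det _; set a := (\sum_(k < d + e) _)%N; set b := (\sum_(k < d + e) _)%N.
move=> coefD; have DN0 : D`_a != 0.
  by apply: contra_eqN coefD => /eqP ->; rewrite coef0 eq_sym signr_eq0.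
have [t] := closed_nonrootP _ DN0; rewrite rootE => tD.
exists a, t; split; first exact: sumE.
suff -> : \det (sylvester (corner_poly p d hp 1) (corner_poly q e hq t) d e) =
  map_poly (horner_eval t) D by rewrite coef_map.
rewrite /D -det_map_mx map_sylvester; congr (\det (sylvester _ _ _ _)).
  by rewrite map_corner_poly /= horner_evalE hornerC.
by rewrite map_corner_poly /= horner_evalE hornerX.
Qed.

(** * Convex hulls and areas *)

Section LowerHull.
Variables (R : realFieldType) (T : eqType) (S : seq T) (X : T -> nat) (Y : T -> R).

Lemma seq_min (I : eqType) (s : seq I) (f : I -> R) : s != [::] ->
  exists2 x, x \in s & forall y, y \in s -> f x <= f y.
Proof.
elim: s => // a [_ _|b s IH _].
  by exists a; rewrite ?mem_head // => y; rewrite inE => /eqP ->.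
have [x xs xm] := IH isT; have [ax|xa] := leP (f a) (f x).
  exists a; rewrite ?mem_head // => y; rewrite inE => /predU1P[-> //|/xm].
  exact: le_trans.
exists x; first by rewrite inE xs orbT.
by move=> y; rewrite inE => /predU1P[->|/xm //]; apply: ltW.
Qed.

Lemma separating_value (l r : seq R) :
    (forall x y, x \in l -> y \in r -> x <= y) ->
  exists z, (forall x, x \in l -> x <= z) /\ (forall y, y \in r -> z <= y).
Proof.
move=> lr; have [->|l0] := eqVneq l [::]; last first.
  have [x xl xm] := seq_min (fun x => - x) l0; exists x; split => y.
    by move=> /xm; rewrite lerN2.
  exact: lr.
have [->|r0] := eqVneq r [::]; first by exists 0.
by have [x xr xm] := seq_min id r0; exists x.
Qed.

(** If both points have the same abscissa, the quotient by 0 is 0 and the height of the first point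
    results. *)
Definition chord n (ab : T * T) : R :=
  Y ab.1 + (n%:R - (X ab.1)%:R) * ((Y ab.2 - Y ab.1) / ((X ab.2)%:R - (X ab.1)%:R)).

Definition straddles n (ab : T * T) := (X ab.1 <= n <= X ab.2)%N.

(** The lower boundary of the hull over n: pairs of points suffice to reach it. *)
Definition chord_min n (v : R) :=
  (exists ab, [/\ ab.1 \in S, ab.2 \in S, straddles n ab & v = chord n ab]) /\
  (forall a b, a \in S -> b \in S -> straddles n (a, b) -> v <= chord n (a, b)).

Lemma chord_left n (ab : T * T) : X ab.1 = n -> chord n ab = Y ab.1.
Proof. by rewrite /chord => ->; rewrite subrr mul0r addr0. Qed.

Lemma chord_cross n (ab : T * T) (v : R) : (X ab.1 < X ab.2)%N ->
  (v <= chord n ab) = (v * ((X ab.2)%:R - (X ab.1)%:R) <=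
    Y ab.1 * ((X ab.2)%:R - n%:R) + Y ab.2 * (n%:R - (X ab.1)%:R)).
Proof.
move=> lt; have lt' : 0 < (X ab.2)%:R - (X ab.1)%:R :> R by rewrite subr_gt0 ltr_nat.
rewrite -(ler_pM2r lt') /chord mulrDl mulrA divfK ?gt_eqF //.
by congr (_ <= _); ring.
Qed.

Lemma chord_right n (ab : T * T) : (X ab.1 < n)%N -> X ab.2 = n -> chord n ab = Y ab.2.
Proof.
move=> lt e; rewrite /chord e mulrC divfK; first by ring.
by rewrite subr_eq0 eqr_nat gtn_eqF.
Qed.

Lemma exists_chord_min n : (exists2 a, a \in S & X a <= n)%N ->
  (exists2 b, b \in S & n <= X b)%N -> exists v, chord_min n v.
Proof.
move=> [a aS an] [b bS nb].
pose s := [seq ab <- [seq (a, b) | a <- S, b <- S] | straddles n ab].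
have abs : (a, b) \in s by rewrite mem_filter /straddles an nb allpairs_f.
have [x xs xm] := @seq_min _ s (chord n) ltac:(by case: (s) abs).
exists (chord n x); split.
  exists x; move: xs; rewrite mem_filter => /andP[st /allpairsP[[u v] [uS vS xE]]].
  by rewrite xE in st *; split.
by move=> u v uS vS uv; apply: xm; rewrite mem_filter uv allpairs_f.
Qed.

(** A minimal chord with ends strictly on both sides of n is itself a supporting line. Otherwise a
    point realizes v, and minimality puts the slopes towards points on the left below those towards
    points on the right, leaving room for sl. *)
Lemma chord_min_support n v : chord_min n v ->
  ((exists2 x, x \in S & X x = n /\ Y x = v) /\
   exists sl : R, forall x, x \in S -> v + sl * ((X x)%:R - n%:R) <= Y x) \/
  (exists a b, exists sl : R, [/\ a \in S, b \in S, (X a < n < X b)%N &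
     [/\ Y a = v + sl * ((X a)%:R - n%:R), Y b = v + sl * ((X b)%:R - n%:R) &
     forall x, x \in S -> v + sl * ((X x)%:R - n%:R) <= Y x]]).
Proof.
move=> [[[a b] [/= aS bS /andP[/= an nb] vE]] vm].
have [/andP[lan lnb]|nint] := boolP (X a < n < X b)%N.
  right; pose sl := (Y b - Y a) / ((X b)%:R - (X a)%:R).
  have ab0 : (X b)%:R - (X a)%:R != 0 :> R.
    by rewrite subr_eq0 eqr_nat gtn_eqF // (ltn_trans lan).
  have Ya : Y a = v + sl * ((X a)%:R - n%:R) by rewrite vE /chord /= -/sl; ring.
  have Yb : Y b = v + sl * ((X b)%:R - n%:R).
    by rewrite vE /chord /= /sl; field.
  exists a, b, sl; rewrite lan lnb; split=> //; split=> // x xS.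
  have [xn|nx] := leqP (X x) n.
    have := vm x b xS bS; rewrite /straddles /= xn ltnW // => /(_ isT).
    rewrite chord_cross /=; last exact: leq_ltn_trans lnb.
    have p0 : 0 < (X b)%:R - n%:R :> R by rewrite subr_gt0 ltr_nat.
    by rewrite Yb => h; rewrite -(ler_pM2r p0); lra.
  have := vm a x aS xS; rewrite /straddles /= an ltnW // => /(_ isT).
  rewrite chord_cross /=; last exact: ltn_trans nx.
  have p0 : 0 < n%:R - (X a)%:R :> R by rewrite subr_gt0 ltr_nat.
  by rewrite Ya => h; rewrite -(ler_pM2r p0); lra.
left; have [x xS [Xx Yx]] : exists2 x, x \in S & X x = n /\ Y x = v.
  have [e|ne] := eqVneq (X a) n; first by exists a; rewrite // vE chord_left.
  have lan : (X a < n)%N by rewrite ltn_neqAle ne.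
  have e : X b = n by apply/eqP; move: nint; rewrite lan /= -leqNgt eqn_leq => ->.
  by exists b; rewrite // vE chord_right.
split; first by exists x.
pose l := [seq (v - Y y) / (n%:R - (X y)%:R) | y <- S & (X y < n)%N].
pose r := [seq (Y y - v) / ((X y)%:R - n%:R) | y <- S & (n < X y)%N].
have [|sl [hl hr]] := @separating_value l r.
  move=> _ _ /mapP[y + ->] /mapP[z + ->].
  rewrite !mem_filter => /andP[yn yS] /andP[nz zS].
  have p1 : 0 < n%:R - (X y)%:R :> R by rewrite subr_gt0 ltr_nat.
  have p2 : 0 < (X z)%:R - n%:R :> R by rewrite subr_gt0 ltr_nat.
  have := vm y z yS zS; rewrite /straddles /= (ltnW yn) (ltnW nz) => /(_ isT).
  rewrite chord_cross /=; last exact: ltn_trans nz.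
  by move=> h; rewrite ler_pdivrMr // mulrAC ler_pdivlMr //; lra.
exists sl => y yS; have [yn|ny|yn] := ltngtP (X y) n.
- have p1 : 0 < n%:R - (X y)%:R :> R by rewrite subr_gt0 ltr_nat.
  have /hl : (v - Y y) / (n%:R - (X y)%:R) \in l.
    by apply/mapP; exists y; rewrite ?mem_filter ?yn.
  by rewrite ler_pdivrMr //; lra.
- have p1 : 0 < (X y)%:R - n%:R :> R by rewrite subr_gt0 ltr_nat.
  have /hr : (Y y - v) / ((X y)%:R - n%:R) \in r.
    by apply/mapP; exists y; rewrite ?mem_filter ?ny.
  by rewrite ler_pdivlMr //; lra.
- rewrite yn subrr mulr0 addr0.
  by have := vm y y yS yS; rewrite chord_left // /straddles /= yn leqnn; apply.
Qed.

Lemma chord_ge n (ab : T * T) v sl (m : R) : straddles n ab ->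
    v + sl * ((X ab.1)%:R - m) <= Y ab.1 -> v + sl * ((X ab.2)%:R - m) <= Y ab.2 ->
  v + sl * (n%:R - m) <= chord n ab.
Proof.
case: ab => a b; rewrite /straddles /= => /andP[an nb] ha hb.
have [e|ne] := eqVneq (X a) n; first by rewrite chord_left // -e.
have lan : (X a < n)%N by rewrite ltn_neqAle ne.
rewrite chord_cross /=; last exact: leq_trans nb.
have p1 : 0 <= (X b)%:R - n%:R :> R by rewrite subr_ge0 ler_nat.
have p2 : 0 <= n%:R - (X a)%:R :> R by rewrite subr_ge0 ler_nat.
by have := ler_wpM2r p1 ha; have := ler_wpM2r p2 hb; lra.
Qed.

(** The value l i is the least chord height over column c + i, and the supporting line at each
    column gives convexity. *)
Lemma lower_hull c d : (forall x, x \in S -> c <= X x <= c + d)%N ->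
    (exists2 a, a \in S & X a = c) -> (exists2 b, b \in S & X b = c + d)%N ->
  exists l : nat -> R,
    [/\ forall x, x \in S -> l (X x - c)%N <= Y x,
       convex_seq l d,
       forall i, (i <= d)%N -> corner l d i ->
         exists2 x, x \in S & X x = (c + i)%N /\ Y x = l i &
       forall i, (i <= d)%N -> exists ab,
         [/\ ab.1 \in S, ab.2 \in S, straddles (c + i) ab & l i = chord (c + i) ab]].
Proof.
move=> SX [a0 a0S a0X] [b0 b0S b0X].
have ex i : exists v, (i <= d)%N -> chord_min (c + i) v.
  have [id|_] := leqP i d; last by exists 0.
  have [||v hv] := @exists_chord_min (c + i)%N; last by exists v.
    by exists a0; rewrite // a0X leq_addr.
  by exists b0; rewrite // b0X leq_add2l.
have [l hl] := choice ex; exists l; split.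
- move=> x xS; have /andP[cx xd] := SX x xS.
  have [|_ /(_ x x xS xS)] := hl (X x - c)%N; first by rewrite leq_subLR.
  by rewrite subnKC // chord_left // /straddles /= leqnn; apply.
- move=> i id.
  have [sl hsl] : exists sl : R, forall x, x \in S ->
      l i.+1 + sl * ((X x)%:R - (c + i.+1)%:R) <= Y x.
    have [[_ //]|[a [b [sl [_ _ _ [_ _ h]]]]]] := chord_min_support (hl i.+1 (ltnW id)).
    by exists sl.
  have sup j : (j <= d)%N -> l i.+1 + sl * ((c + j)%:R - (c + i.+1)%:R) <= l j.
    move=> jd; have [[ab [h1 h2 st ->]] _] := hl j jd.
    by apply: chord_ge => //; apply: hsl.
  have := sup i (ltnW (ltnW id)); have := sup i.+2 id.
  by rewrite /slope !natrD -!natr1; lra.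
- move=> i id ci.
  have [[[x xS [Xx Yx]] _]|[a [b [sl [aS bS /andP[ai ib] [Ya Yb h]]]]]] :=
    chord_min_support (hl i id); first by exists x.
  (* The values of l next to i lie on or below the chord from a to b, which passes through l i; so
     the slope cannot increase at i. *)
  exfalso; have /andP[ca _] := SX a aS; have /andP[_ bd] := SX b bS.
  move: ci; rewrite /corner; have [i0|i0] /= := eqVneq i 0%N.
    by move: ai; rewrite i0; lia.
  have [ied|ied] /= := eqVneq i d; first by move: ib; rewrite ied; lia.
  apply/negP; rewrite -leNgt.
  have lt0 : (X a < X b)%N by apply: ltn_trans ib.
  have := hl i.-1; have := hl i.+1; case: i i0 {h} id ai ib Ya Yb ied => //= i _ id ai ib Ya Yb ied.
  move=> [|_ /(_ a b aS bS)]; first by lia.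
  rewrite chord_cross //= => /(_ ltac:(rewrite /straddles /=; lia)) h1.
  move=> [|_ /(_ a b aS bS)]; first by lia.
  rewrite chord_cross //= => /(_ ltac:(rewrite /straddles /=; lia)) h2.
  have p : 0 < (X b)%:R - (X a)%:R :> R by rewrite subr_gt0 ltr_nat.
  rewrite /slope -(ler_pM2r p); move: h1 h2.
  by rewrite Ya Yb !natrD -!natr1; lra.
- by move=> i id; have [+ _] := hl i id.
Qed.

End LowerHull.

(** * Boundaries of plane convex sets *)

Section Plane.
Variable R : realType.
Implicit Types (C D : set (R * R)) (sg : R).

Definition plane_convex C := forall z w (t : R), 0 <= t -> t <= 1 ->
  C z -> C w -> C ((1 - t) * z.1 + t * w.1, (1 - t) * z.2 + t * w.2).

Lemma convex_setE C : @convex_set R (R * R)%type C <-> plane_convex C.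
Proof.
split=> cC z w t.
  move=> t0 t1 Cz Cw; have /set_mem := cC w z (Itv01 t0 t1) (mem_set Cw) (mem_set Cz).
  congr (C _); rewrite /conv /= /convex.conv /=.
  by congr pair; rewrite addrC.
move=> /set_mem Cz /set_mem Cw; apply/mem_set.
have t0 : 0 <= t%:num by exact: ge0.
have t1 : t%:num <= 1 by exact: le1.
have := cC w z t%:num t0 t1 Cw Cz; congr (C _).
by rewrite /conv /= /convex.conv /=; congr pair; rewrite addrC.
Qed.

(* The side of C towards sg * (-oo) is the graph of sg times the piecewise
   linear interpolation of l over [c, c + d]. *)
Definition boundary sg C c d (l : nat -> R) :=
  [/\ forall z, C z -> c%:R <= z.1 <= (c + d)%:R,
     forall i, (i <= d)%N -> C ((c + i)%:R, sg * l i) &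
     forall al be, (forall i, (i <= d)%N -> al + be * (c + i)%:R <= l i) ->
       forall z, C z -> al + be * z.1 <= sg * z.2].

(** A line of slope be below m splits into two: the highest line of this slope below p, with
    intercept al', bounds C, and the remaining intercept al - al' gives a line below q. *)
Lemma boundary_sum sg C D c c' d e p q m :
    boundary sg C c d p -> boundary sg D c' e q ->
    (forall i j, (i <= d)%N -> (j <= e)%N -> m (i + j)%N <= p i + q j) ->
    (forall k, (k <= d + e)%N -> exists i j,
      [/\ (i <= d)%N, (j <= e)%N, k = (i + j)%N & m k = p i + q j]) ->
  boundary sg (minkowski_sum C D) (c + c') (d + e) m.
Proof.
move=> [rC pC bC] [rD pD bD] mle mex; split.
- move=> _ [z Cz [w Dw <-]] /=.
  by have := rC z Cz; have := rD w Dw; rewrite !natrD; lra.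
- move=> k /mex[i [j [id je -> ->]]].
  exists ((c + i)%:R, sg * p i); first exact: pC.
  exists ((c' + j)%:R, sg * q j); first exact: pD.
  by apply: injective_projections; rewrite /= ?natrD; ring.
- move=> al be h _ [z Cz [w Dw <-]] /=.
  have [i + imin] := @seq_min R _ (iota 0 d.+1) (fun i => p i - be * (c + i)%:R) isT.
  rewrite mem_iota add0n ltnS => /andP[_ id].
  set al' := p i - be * (c + i)%:R.
  have hz : al' + be * z.1 <= sg * z.2.
    apply: bC => // j jd; have := imin j; rewrite mem_iota add0n ltnS jd.
    by move=> /(_ isT); rewrite -/al'; lra.
  have hw : (al - al') + be * w.1 <= sg * w.2.
    apply: bD => // j je; have := h (i + j)%N; rewrite leq_add // => /(_ isT).
    by have := mle i j id je; rewrite /al' !natrD; lra.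
  by lra.
Qed.

Lemma boundary_line sg C c d l i : convex_seq l d -> boundary sg C c d l ->
  (i < d)%N -> forall z, C z ->
  l i + slope l i * (z.1 - (c + i)%:R) <= sg * z.2.
Proof.
move=> cl [_ _ bC] id z Cz.
have := bC (l i - slope l i * (c + i)%:R) (slope l i) _ z Cz.
suff h j : (j <= d)%N ->
    l i - slope l i * (c + i)%:R + slope l i * (c + j)%:R <= l j.
  by move=> /(_ h); lra.
move=> jd; rewrite !natrD; have [ji|ij|->] := ltngtP j i; last by lra.
  have := @convex_le _ l d j (i - j) cl; rewrite subnKC ?(ltnW ji) // subn_gt0.
  move=> /(_ (ltnW id) ji); rewrite natrB ?(ltnW ji) //.
  have s : slope l i.-1 <= slope l i by apply: (convex_slope_le cl) => //; exact: leq_pred.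
  have p : 0 <= i%:R - j%:R :> R by rewrite subr_ge0 ler_nat ltnW.
  by have := ler_wpM2l p s; lra.
have := @convex_ge _ l d i (j - i) cl; rewrite subnKC ?(ltnW ij) // subn_gt0.
by move=> /(_ jd ij); rewrite natrB ?(ltnW ij) //; lra.
Qed.

Lemma boundary_section C c d l u i (th h : R) :
    plane_convex C -> convex_seq l d -> convex_seq u d ->
    boundary 1 C c d l -> boundary (-1) C c d u ->
    (i < d)%N -> 0 <= th -> th <= 1 ->
  C ((c + i)%:R + th, h) <->
  (1 - th) * l i + th * l i.+1 <= h <= - ((1 - th) * u i + th * u i.+1).
Proof.
move=> cC cl cu bl bu id th0 th1; split.
  move=> Ch; have := boundary_line cl bl id Ch; have := boundary_line cu bu id Ch.
  by rewrite /= /slope; lra.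
move=> /andP[h1 h2].
have [[_ pl _] [_ pu _]] := (bl, bu).
pose lo := (1 - th) * l i + th * l i.+1.
pose up := - ((1 - th) * u i + th * u i.+1).
have Clo : C ((c + i)%:R + th, lo).
  have := cC _ _ th th0 th1 (pl i (ltnW id)) (pl i.+1 id).
  by congr (C (_, _)); rewrite /= ?addnS -?natr1 /lo; ring.
have Cup : C ((c + i)%:R + th, up).
  have := cC _ _ th th0 th1 (pu i (ltnW id)) (pu i.+1 id).
  by congr (C (_, _)); rewrite /= ?addnS -?natr1 /up; ring.
rewrite -/lo in h1; rewrite -/up in h2; clearbody lo up.
have [e|ne] := eqVneq lo up.
  suff -> : h = lo by [].
  by apply/eqP; rewrite eq_le h1 andbT e.
have lu : 0 < up - lo by rewrite subr_gt0 lt_neqAle ne (le_trans h1).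
have t0 : 0 <= (h - lo) / (up - lo) by rewrite divr_ge0 ?(ltW lu) // subr_ge0.
have t1 : (h - lo) / (up - lo) <= 1 by rewrite ler_pdivrMr // mul1r lerD2r.
have := cC _ _ _ t0 t1 Clo Cup; congr (C (_, _)) => /=; first by ring.
by field; exact: lt0r_neq0.
Qed.

Lemma boundary_le C c d l u i : plane_convex C -> convex_seq l d -> convex_seq u d ->
  boundary 1 C c d l -> boundary (-1) C c d u -> (i <= d)%N -> (0 < d)%N ->
  0 <= - u i - l i.
Proof.
move=> cC cl cu bl bu id d0; have [_ pl _] := bl.
have := pl i id; rewrite mul1r => Ci.
have [lt|ge] := ltnP i d.
  have := boundary_section (l i) cC cl cu bl bu lt (lexx 0) ler01.
  by rewrite addr0 => -[/(_ Ci) + _]; lra.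
have {}ge : i = d by apply/eqP; rewrite eqn_leq id.
have lt : (d.-1 < d)%N by rewrite prednK.
have := boundary_section (l i) cC cl cu bl bu lt ler01 (lexx 1).
have -> : (c + d.-1)%:R + 1 = (c + i)%:R :> R.
  by rewrite natr1 -addnS prednK // ge.
by rewrite prednK // -ge => -[/(_ Ci) + _]; lra.
Qed.

End Plane.

(** * Area between the two boundaries *)

Section Area.
Import numFieldNormedType.Exports.
Variable R : realType.
Implicit Types (C D : set (R * R)).
Local Notation mu := (@lebesgue_measure R).

Lemma integral_affine (a al be : R) :
  (\int[mu]_(x in `[a, (a + 1)%R[) (al + be * x)%:E)%E = (al + be * a + be / 2)%:E.
Proof.
have cont : continuous (fun x : R => al + be * x).
  move=> x; apply: cvgD; first exact: cvg_cst.
  by apply: cvgM; [exact: cvg_cst | exact: cvg_id].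
rewrite integral_itv_bndo_bndc; last first.
  apply/measurable_EFinP; apply: measurable_funTS.
  exact: continuous_measurable_fun.
pose G (x : R) := al * x + (be / 2) * x ^+ 2.
have dG (x : R) : is_derive x 1 G (al + be * x).
  rewrite /G; apply: is_derive_eq.
  by rewrite /GRing.scale /=; field.
have cG : continuous G.
  move=> x; apply: differentiable_continuous.
  by apply/derivable1_diffP; case: (dG x).
rewrite (@continuous_FTC2 _ _ G).
- by rewrite -EFinB /G; congr EFin; field.
- by rewrite ltrDl.
- by apply: continuous_subspaceT.
- split.
  + by move=> x _; case: (dG x).
  + by apply: cvg_at_right_filter; exact: cG.
  + by apply: cvg_at_left_filter; exact: cG.
- move=> x _; rewrite derive1E; exact: derive_val.
Qed.


Variables (C : set (R * R)) (c d : nat) (l u : nat -> R).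
Hypotheses (cC : plane_convex C) (cl : convex_seq l d) (cu : convex_seq u d)
  (bl : boundary 1 C c d l) (bu : boundary (-1) C c d u).

Let I i : set R := `[(c + i)%:R, ((c + i)%:R + 1)%R[.

Let height i : R := - u i - l i.

Let g i (x : R) := height i + slope height i * (x - (c + i)%:R).

Lemma section_measure i x : (i < d)%N -> I i x ->
  mu (xsection C x) = (g i x)%:E.
Proof.
rewrite /I /= in_itv /= => id /andP[x0 x1].
pose th := x - (c + i)%:R; have xE : x = (c + i)%:R + th by rewrite /th; ring.
have th0 : 0 <= th by rewrite subr_ge0.
have th1 : th <= 1 by rewrite /th; lra.
pose lo := (1 - th) * l i + th * l i.+1.
pose up := - ((1 - th) * u i + th * u i.+1).
have -> : xsection C x = `[lo, up]%classic.
  apply/seteqP; split => h.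
    move=> /xsectionP; rewrite xE /= in_itv /=.
    by move=> /(boundary_section h cC cl cu bl bu id th0 th1).
  rewrite /= in_itv /= => hh; apply/xsectionP; rewrite xE.
  exact/(boundary_section h cC cl cu bl bu id th0 th1).
have gE : g i x = up - lo by rewrite /g /slope /height -/th /up /lo; ring.
have d0 : (0 < d)%N by apply: leq_ltn_trans id.
have h0 : 0 <= up - lo.
  have := boundary_le cC cl cu bl bu (ltnW id) d0.
  have := boundary_le cC cl cu bl bu id d0 => h1 h2.
  have t1 : 0 <= 1 - th by rewrite subr_ge0.
  by have := mulr_ge0 th0 h1; have := mulr_ge0 t1 h2; rewrite /up /lo; lra.
rewrite lebesgue_measure_itv /= lte_fin gE; case: ltP => // le.
have -> : up - lo = 0 by lra.
by [].
Qed.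

Lemma area_boundary : area C = (- trapezoids u d - trapezoids l d)%:E.
Proof.
pose F (x : R) := mu (xsection C x).
pose G i : R -> \bar R := (EFin \o g i) \_ (I i).
(* The half-open unit strips miss the last column. It has measure zero, and for d = 0 it contains
   the whole set. *)
pose E : R -> \bar R := (fun=> F (c + d)%:R) \_ [set (c + d)%:R].
have disj (i j : nat) x : I i x -> I j x -> i = j.
  rewrite /I /= !in_itv /= => /andP[i1 i2] /andP[j1 j2].
  have h (a b : nat) : (c + a)%:R <= x -> x < (c + b)%:R + 1 -> (a <= b)%N.
    move=> h1 h2; have := le_lt_trans h1 h2.
    by rewrite natr1 ltr_nat ltnS leq_add2l.
  by apply/eqP; rewrite eqn_leq !h.
have FE x : F x = (\sum_(i < d) G i x + E x)%E.
  have [[i Ix]|nI] := pselect (exists i : 'I_d, I i x).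
    rewrite /F (section_measure (ltn_ord i) Ix) (bigD1 i) //= big1 => [|j ji].
      rewrite /G /E !patchE (mem_set Ix) adde0 ifF ?adde0 //.
      apply/negP => /set_mem /= xE; move: Ix.
      rewrite /I /= in_itv /= xE => /andP[_].
      by rewrite natr1 ltr_nat ltnS leq_add2l leqNgt ltn_ord.
    rewrite /G patchE ifF //; apply/negP => /set_mem Jx.
    by case/eqP: ji; apply: val_inj; apply: disj Jx Ix.
  rewrite big1 ?add0e => [|i _]; last first.
    by rewrite /G patchE ifF //; apply/negP => /set_mem Jx; apply: nI; exists i.
  rewrite /E patchE; case: ifP => [/set_mem /= -> //|/negP xE].
  have -> : F x = mu set0; last by rewrite measure0.
  congr (mu _); apply/seteqP; split => // h /xsectionP Ch.
  have [rC _ _] := bl; have /andP[/= cx xd] := rC _ Ch; apply: nI.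
  have xc : 0 <= x - c%:R by rewrite subr_ge0.
  have /andP[t1 t2] := truncn_itv xc.
  have lt : (Num.truncn (x - c%:R) < d)%N.
    rewrite -(ltr_nat R) (le_lt_trans t1) // ltrBlDl -natrD lt_neqAle xd andbT.
    by apply: contra_notN xE => /eqP xE; apply/mem_set.
  exists (Ordinal lt); rewrite /I /= in_itv /= natrD.
  by move: t1 t2; rewrite -natr1; lra.
have Gm i : measurable_fun setT (G i).
  have mI : measurable (I i) by exact: measurable_itv.
  apply/(measurable_restrictT _ mI).
  apply/measurable_EFinP; apply: measurable_funTS.
  apply: continuous_measurable_fun => x; apply: cvgD; first exact: cvg_cst.
  by apply: cvgM; [exact: cvg_cst | apply: cvgB; [exact: cvg_id | exact: cvg_cst]].
have F0 x : (0 <= F x)%E by exact: measure_ge0.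
have G0 (i : 'I_d) x : (0 <= G i x)%E.
  rewrite /G patchE; case: ifP => // /set_mem Ix.
  by rewrite /= -(section_measure (ltn_ord i) Ix).
have E0 x : (0 <= E x)%E by rewrite /E patchE; case: ifP.
have Em : measurable_fun setT E.
  by apply/(measurable_restrictT _ (measurable_set1 _)); exact: measurable_cst.
have -> : area C = (\int[mu]_x (\sum_(i < d) G i x + E x))%E.
  by apply: eq_integral => x _; exact: FE.
rewrite ge0_integralD //; last 2 first.
  by move=> x _; apply: sume_ge0.
  by apply: emeasurable_sum => i; exact: Gm.
rewrite [X in (_ + X)%E](_ : _ = 0%E) ?adde0; last first.
  by rewrite /E -integral_mkcond integral_set1.
rewrite ge0_integral_sum //; last by move=> i; exact: Gm.
rewrite /trapezoids -!sumrN -big_split /= -sumEFin; apply: eq_bigr => i _.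
rewrite /G -integral_mkcond /I.
transitivity (\int[mu]_(x in `[(c + i)%:R, ((c + i)%:R + 1)%R[)
  ((height i - slope height i * (c + i)%:R) + slope height i * x)%:E)%E.
  by apply: eq_integral => x _; congr EFin; rewrite /g; ring.
by rewrite integral_affine /slope /height; congr EFin; field.
Qed.

End Area.

(** * Mixed volume of convex hulls *)

Section MixedArea.
Variable R : realType.
Implicit Types (C D : set (R * R)).

Lemma convex_hull_sub (S : set (R * R)) z : S z -> convex_hull S z.
Proof. by move=> Sz M [_]; apply. Qed.

Lemma convex_hull_min (S M : set (R * R)) : plane_convex M -> S `<=` M ->
  convex_hull S `<=` M.
Proof. by move=> cM SM z; apply; split=> //; apply/convex_setE. Qed.

Lemma convex_hull_convex (S : set (R * R)) : plane_convex (convex_hull S).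
Proof.
move=> z w t t0 t1 Sz Sw M [cM SM].
have /convex_setE := cM; apply=> //; [exact: Sz|exact: Sw].
Qed.

Lemma plane_convex_minkowski C D : plane_convex C -> plane_convex D ->
  plane_convex (minkowski_sum C D).
Proof.
move=> cC cD _ _ t t0 t1 [z Cz [w Dw <-]] [z' Cz' [w' Dw' <-]].
exists ((1 - t) * z.1 + t * z'.1, (1 - t) * z.2 + t * z'.2); first exact: cC.
exists ((1 - t) * w.1 + t * w'.1, (1 - t) * w.2 + t * w'.2); first exact: cD.
by apply: injective_projections; rewrite /=; ring.
Qed.

(** The sign -1 reflects the points, so that the upper side is obtained as a lower hull. *)
Lemma hull_boundary (T : eqType) (S : seq T) (X : T -> nat) (H : T -> R)
    (sg : R) c d :
    sg * sg = 1 -> (forall x, x \in S -> c <= X x <= c + d)%N ->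
    (exists2 a, a \in S & X a = c) -> (exists2 b, b \in S & X b = c + d)%N ->
  exists l : nat -> R,
    [/\ forall x, x \in S -> l (X x - c)%N <= sg * H x,
       convex_seq l d,
       forall i, (i <= d)%N -> corner l d i ->
         exists2 x, x \in S & X x = (c + i)%N /\ sg * H x = l i &
       boundary sg (convex_hull [set ((X m)%:R, H m) | m in [set m | m \in S]])
         c d l].
Proof.
move=> sg2 SX Sc Sd; have [l [lS lc lk lch]] := @lower_hull _ _ _ _ (fun x => sg * H x) _ _ SX Sc Sd.
exists l; split=> //; set P := [set _ | m in _]; split.
- apply: (@convex_hull_min _ [set z | c%:R <= z.1 <= (c + d)%:R]).
    move=> z w t t0 t1 /= /andP[z1 z2] /andP[w1 w2].
    have t1' : 0 <= 1 - t by rewrite subr_ge0.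
    have := ler_wpM2l t0 w1; have := ler_wpM2l t0 w2.
    have := ler_wpM2l t1' z1; have := ler_wpM2l t1' z2 => *.
    by apply/andP; split; lra.
  by move=> _ [m /SX /andP[m1 m2] <-] /=; rewrite !ler_nat m1.
- move=> i id; have [[a b] [/= aS bS]] := lch i id.
  rewrite /straddles /= => /andP[an nb] ->.
  have Pa : convex_hull P ((X a)%:R, H a) by apply: convex_hull_sub; exists a.
  have Pb : convex_hull P ((X b)%:R, H b) by apply: convex_hull_sub; exists b.
  have [e|ne] := eqVneq (X a) (c + i)%N.
    by rewrite chord_left // mulrA sg2 mul1r -e.
  have lt : (X a < c + i)%N by rewrite ltn_neqAle ne.
  have p : 0 < (X b)%:R - (X a)%:R :> R by rewrite subr_gt0 ltr_nat (leq_trans lt).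
  pose t : R := ((c + i)%:R - (X a)%:R) / ((X b)%:R - (X a)%:R).
  have t0 : 0 <= t by rewrite divr_ge0 ?(ltW p) // subr_ge0 ler_nat.
  have t1 : t <= 1 by rewrite ler_pdivrMr // mul1r lerD2r ler_nat.
  have := convex_hull_convex t0 t1 Pa Pb; congr (convex_hull _ (_, _)) => /=.
    by rewrite /t; field; exact: lt0r_neq0.
  rewrite /chord /=; transitivity ((sg * sg) * ((1 - t) * H a + t * H b)).
    by rewrite sg2 mul1r.
  by rewrite /t; field; exact: lt0r_neq0.
- move=> al be h; apply: convex_hull_min.
    move=> z w t t0 t1 /= hz hw; have t1' : 0 <= 1 - t by rewrite subr_ge0.
    by have := ler_wpM2l t0 hw; have := ler_wpM2l t1' hz; lra.
  move=> _ [m mS <-] /=; have /andP[m1 m2] := SX m mS.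
  apply: le_trans (lS m mS); have := h (X m - c)%N.
  by rewrite leq_subLR m2 subnKC //; apply.
Qed.

Lemma merge_boundary sg C D c c' d e p q :
    convex_seq p d -> convex_seq q e ->
    boundary sg C c d p -> boundary sg D c' e q ->
  boundary sg (minkowski_sum C D) (c + c') (d + e) (merge_val d e p q).
Proof.
move=> cp cq bp bq; apply: boundary_sum bp bq _ _.
  by move=> i j id je; have [] := merge_val_le cp cq id je.
move=> k kn; have [I1 J1] := merge_le p q kn.
by exists (merge d e p q k).1, (merge d e p q k).2; rewrite merge_sum.
Qed.

Lemma mixed_volume_diag C D c c' d e p q p' q' :
    plane_convex C -> plane_convex D ->
    convex_seq p d -> convex_seq q e -> convex_seq p' d -> convex_seq q' e ->
    boundary 1 C c d p -> boundary 1 D c' e q ->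
    boundary (-1) C c d p' -> boundary (-1) D c' e q' ->
  mixed_volume C D =
    (- \sum_(k < d + e) diag_val d e p' q' k - \sum_(k < d + e) diag_val d e p q k)%:E.
Proof.
move=> cC cD cp cq cp' cq' bC bD bC' bD'; rewrite /mixed_volume.
rewrite (area_boundary cC cp cp' bC bC') (area_boundary cD cq cq' bD bD').
rewrite (area_boundary (plane_convex_minkowski cC cD) (merge_val_convex cp cq)
  (merge_val_convex cp' cq') (merge_boundary cp cq bC bD)
  (merge_boundary cp' cq' bC' bD')).
by rewrite !trapezoids_merge -!EFinB; congr EFin; ring.
Qed.

End MixedArea.

(** * Genericity *)

Section PolynomialFunctions.
Variables (K : closedFieldType) (n : nat).
Implicit Types (u v : 'rV[K]_n -> K) (F G : 'rV[K]_n -> {poly K}).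

Definition polynomial_fun u := exists P : {mpoly K[n]}, forall c, u c = P.@[c 0].

Definition polynomial_family F := forall k, polynomial_fun (fun c => (F c)`_k).

Lemma polynomial_fun_cst a : polynomial_fun (fun=> a).
Proof. by exists a%:MP => c; rewrite mevalC. Qed.

Lemma polynomial_fun_coord i : polynomial_fun (fun c => c 0 i).
Proof. by exists 'X_i => c; rewrite mevalXU. Qed.

Lemma polynomial_funM u v : polynomial_fun u -> polynomial_fun v ->
  polynomial_fun (fun c => u c * v c).
Proof. by move=> [P hP] [Q hQ]; exists (P * Q) => c; rewrite mevalM hP hQ. Qed.

Lemma polynomial_fun_sum I (r : seq I) (u : I -> 'rV[K]_n -> K) :
  (forall i, polynomial_fun (u i)) ->
  polynomial_fun (fun c => \sum_(i <- r) u i c).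
Proof.
move=> h; elim: r => [|i r [P hP]].
  by exists 0 => c; rewrite big_nil meval0.
have [Q hQ] := h i; exists (Q + P) => c.
by rewrite big_cons mevalD hQ hP.
Qed.

Lemma polynomial_family_sum I (r : seq I) (F : I -> 'rV[K]_n -> {poly K}) :
  (forall i, polynomial_family (F i)) ->
  polynomial_family (fun c => \sum_(i <- r) F i c).
Proof.
move=> h k; have [P hP] := polynomial_fun_sum r (fun i => h i k).
by exists P => c; rewrite coef_sum hP.
Qed.

Lemma polynomial_familyM F G : polynomial_family F -> polynomial_family G ->
  polynomial_family (fun c => F c * G c).
Proof.
move=> hF hG k.
have [P hP] := polynomial_fun_sum (index_enum 'I_k.+1)
  (fun i : 'I_k.+1 => polynomial_funM (hF i) (hG (k - i)%N)).
by exists P => c; rewrite coefM hP.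
Qed.

Lemma polynomial_family_cst (p : {poly K}) : polynomial_family (fun=> p).
Proof. by move=> k; exact: polynomial_fun_cst. Qed.

Lemma polynomial_family_prod I (r : seq I) (F : I -> 'rV[K]_n -> {poly K}) :
  (forall i, polynomial_family (F i)) ->
  polynomial_family (fun c => \prod_(i <- r) F i c).
Proof.
move=> h; elim: r => [|i r IH] k.
  by have [P hP] := polynomial_family_cst 1 k; exists P => c; rewrite big_nil (hP c).
have [P hP] := polynomial_familyM (h i) IH k.
by exists P => c; rewrite big_cons hP.
Qed.

Lemma polynomial_family_det m (M : 'rV[K]_n -> 'M[{poly K}]_m) :
  (forall i j, polynomial_family (fun c => M c i j)) ->
  polynomial_family (fun c => \det (M c)).
Proof.
move=> h; apply: polynomial_family_sum => s; apply: polynomial_familyM.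
  exact: polynomial_family_cst.
by apply: polynomial_family_prod => i; exact: h.
Qed.

Lemma polynomial_fun_line u : polynomial_fun u -> forall a b : 'rV[K]_n,
  exists p : {poly K}, forall t, u (a + t *: b) = p.[t].
Proof.
move=> [P hP] a b.
exists (\sum_(m <- msupp P) (P@_m)%:P * \prod_i ((a 0 i)%:P + 'X * (b 0 i)%:P) ^+ m i).
move=> t; rewrite hP mevalE horner_sum; apply: eq_bigr => m _.
rewrite hornerM hornerC horner_prod; congr (_ * _); apply: eq_bigr => i _.
by rewrite !hornerE !mxE.
Qed.

(** On the line through a and b both functions are nonzero polynomials in one variable, and their
    product has a nonroot in K. *)
Lemma polynomial_fun_common_nonzero u v : polynomial_fun u -> polynomial_fun v ->
  (exists a, u a != 0) -> (exists b, v b != 0) -> exists c, u c * v c != 0.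
Proof.
move=> hu hv [a ua] [b vb].
have [p hp] := polynomial_fun_line hu a (b - a).
have [q hq] := polynomial_fun_line hv a (b - a).
have pN0 : p != 0.
  by apply: contraNneq ua => p0; have := hp 0; rewrite scale0r addr0 p0 horner0 => ->.
have qN0 : q != 0.
  apply: contraNneq vb => q0; have := hq 1.
  by rewrite scale1r addrC subrK q0 horner0 => ->.
have /closed_nonrootP[t] := mulf_neq0 pN0 qN0.
by rewrite rootE hornerM -hp -hq; exists (a + t *: (b - a)).
Qed.

End PolynomialFunctions.

(** * Resultants over the base field *)

Section Resultant.
Variable K : closedFieldType.

Lemma sylvester_bezout (f g : {poly K}) d e :
    (size f <= d.+1)%N -> (size g <= e.+1)%N -> (0 < d + e)%N ->
    \det (sylvester f g d e) != 0 ->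
  exists u v, u * f + v * g = 1.
Proof.
move=> szf szg de; rewrite -unitfE -unitmxE => unitS.
pose w := poly_rV 1 *m invmx (sylvester f g d e) : 'rV_(d + e).
exists (take_poly e (rVpoly w)), (drop_poly e (rVpoly w)).
by rewrite -mul_sylvester // mulmxKV // poly_rV_K // size_poly1.
Qed.

(** A relation a x^m + b = 0 with b of degree below m forces a = b = 0. This is the witness that the
    resultants of the columns are not identically zero. *)
Lemma sylvester_Xn1 m e : \det (sylvester ('X^m : {poly K}) 1 m e) != 0.
Proof.
rewrite -unitfE -unitmxE -row_free_unit; apply: inj_row_free => w w0.
have szX : (size ('X^m : {poly K}) <= m.+1)%N by rewrite size_polyXn.
have sz1 : (size (1%R : {poly K}) <= e.+1)%N by rewrite size_poly1.
have := mul_sylvester w szX sz1; rewrite w0 linear0 mulr1 => E.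
have szd : (size (drop_poly e (rVpoly w)) <= m)%N.
  by rewrite size_drop_poly leq_subLR; apply: leq_trans (size_poly _ _) _; rewrite addnC.
have t0 : take_poly e (rVpoly w) = 0.
  apply/polyP => i; have := congr1 (fun p : {poly K} => p`_(i + m)) E.
  rewrite /= coef0 coefD coefMXn ltnNge leq_addl /= addnK.
  by rewrite [X in _ + X]nth_default ?addr0 ?coef0 // (leq_trans szd) ?leq_addl.
move: E; rewrite t0 mul0r add0r => /esym d0.
apply: (can_inj rVpolyK); rewrite linear0.
by rewrite -[LHS](poly_take_drop e) t0 d0 mul0r addr0.
Qed.

End Resultant.

(** * Polynomials with given support *)

Section SupportPolynomials.
Variable K : closedFieldType.
Local Notation S := {poly {poly K}}.

Definition mnm2 i j : 'X_{1..2} := [multinom (if k == ord0 then i else j) | k < 2].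

Lemma mnm2_0 i j : mnm2 i j ord0 = i.
Proof. by rewrite mnmE eqxx. Qed.

Lemma mnm2_max i j : mnm2 i j ord_max = j.
Proof. by rewrite mnmE. Qed.

Lemma ord2P (P : 'I_2 -> Prop) : P ord0 -> P ord_max -> forall i, P i.
Proof.
move=> P0 P1 [[|[|//]] lt]; first by rewrite (_ : Ordinal lt = ord0) //; apply: val_inj.
by rewrite (_ : Ordinal lt = ord_max) //; apply: val_inj.
Qed.

Lemma mnm2E (m : 'X_{1..2}) : mnm2 (m ord0) (m ord_max) = m.
Proof. by apply/mnmP; apply: ord2P; rewrite ?mnm2_0 ?mnm2_max. Qed.

(** The first exponent becomes the outer degree, lowered by x0 so that the leftmost column has
    degree 0; the monomial removed is a unit on the torus. *)
Definition support_poly (A : seq 'X_{1..2}) x0 (phi : 'X_{1..2} -> K) : S :=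
  \sum_(m <- A) ((phi m)%:P * 'X^(m ord_max)) *: 'X^(m ord0 - x0).

Lemma coef_support_poly (A : seq 'X_{1..2}) x0 phi k h : uniq A ->
    (forall m, m \in A -> x0 <= m ord0)%N ->
  ((support_poly A x0 phi)`_k)`_h =
    if mnm2 (x0 + k) h \in A then phi (mnm2 (x0 + k) h) else 0.
Proof.
move=> uA hA; rewrite !coef_sum.
have E m : m \in A -> ((((phi m)%:P * 'X^(m ord_max)) *: 'X^(m ord0 - x0))`_k)`_h =
    if m == mnm2 (x0 + k) h then phi m else 0 :> K.
  move=> mA; rewrite coefZ coefXn -mulrA coefCM.
  have -> : (m == mnm2 (x0 + k) h) = (k == m ord0 - x0)%N && (h == m ord_max).
    rewrite -{1}[m]mnm2E; apply/eqP/andP => [e|[/eqP -> /eqP ->]].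
      have := congr1 (fun m : 'X_{1..2} => m ord0) e.
      have := congr1 (fun m : 'X_{1..2} => m ord_max) e.
      by rewrite /= !mnm2_max !mnm2_0 => -> ->; rewrite addKn !eqxx.
    by rewrite subnKC ?hA.
  case: eqP => /= _; last by rewrite mulr0 coef0 mulr0.
  by rewrite mulr1 coefXn; case: eqP => _; rewrite ?mulr1 ?mulr0.
rewrite (eq_big_seq _ E) -big_mkcond /=.
case: ifP => mA; last first.
  by rewrite big_seq_cond big1 // => m /andP[+ /eqP e]; rewrite e mA.
rewrite (big_rem _ mA) /= eqxx big_seq_cond big1 ?addr0 // => m /andP[mr /eqP e].
by rewrite e mem_rem_uniqF in mr.
Qed.

Variables (A : {fset 'X_{1..2}}) (x0 : nat).
Hypothesis hA : forall m, m \in A -> (x0 <= m ord0)%N.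

Definition row_coef (v : 'rV[K]_(#|` A|)) m : K := oapp (v 0) 0 (insub (index m A)).

Definition row_poly v : S := support_poly A x0 (row_coef v).

Lemma coef_row_poly v k h : ((row_poly v)`_k)`_h =
  if mnm2 (x0 + k) h \in A then row_coef v (mnm2 (x0 + k) h) else 0.
Proof. by rewrite /row_poly coef_support_poly ?fset_uniq. Qed.

Definition row_of (phi : 'X_{1..2} -> K) : 'rV[K]_(#|` A|) :=
  \row_i phi (nth 0%MM A i).

Lemma row_coefE phi m : m \in A -> row_coef (row_of phi) m = phi m.
Proof.
move=> mA; have lt : (index m A < #|` A|)%N by rewrite index_mem.
by rewrite /row_coef insubT /= mxE nth_index.
Qed.

Lemma row_poly_onto (F : S) :
    (forall k h, (F`_k)`_h != 0 -> mnm2 (x0 + k) h \in A) ->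
  row_poly (row_of (fun m => (F`_(m ord0 - x0))`_(m ord_max))) = F.
Proof.
move=> hF; apply/polyP => k; apply/polyP => h; rewrite coef_row_poly.
case: ifP => [mA|/negbT mA].
  by rewrite row_coefE // mnm2_0 mnm2_max addKn.
by apply/esym/eqP; apply: contraR mA; exact: hF.
Qed.

Lemma size_row_poly v d : (forall m, m \in A -> m ord0 <= x0 + d)%N ->
  (size (row_poly v) <= d.+1)%N.
Proof.
move=> hd; apply/leq_sizeP => k dk; apply/polyP => h; rewrite coef_row_poly coef0.
case: ifP => // /hd; rewrite mnm2_0 leq_add2l => kd.
by have := leq_ltn_trans kd dk; rewrite ltnn.
Qed.

End SupportPolynomials.

(** * Two variables as one variable over [{poly K}] *)

Section Bivariate.
Variable K : closedFieldType.
Local Notation S := {poly {poly K}}.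

Definition bivar : {rmorphism {mpoly K[2]} -> S} :=
  mmap (polyC \o polyC) (fun i : 'I_2 => if i == ord0 then 'X else 'X%:P).

Definition bivar_inv (p : S) : {mpoly K[2]} :=
  (map_poly (horner_eval 'X_ord_max \o map_poly (@mpolyC 2 K)) p).['X_ord0].

Lemma bivarC c : bivar c%:MP = c%:P%:P.
Proof. exact: mmapC. Qed.

Lemma bivarXU i : bivar 'X_i = if i == ord0 then 'X else 'X%:P.
Proof.
transitivity (mmap1 (fun i : 'I_2 => if i == ord0 then 'X else 'X%:P : S) U_(i)).
  exact: mmapX.
exact: mmap1U.
Qed.

Lemma mmap1_bivar (m : 'X_{1..2}) :
  mmap1 (fun i : 'I_2 => if i == ord0 then 'X else 'X%:P) m =
  'X^(m ord0) * ('X%:P) ^+ (m ord_max) :> S.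
Proof.
rewrite /mmap1 !big_ord_recl big_ord0 mulr1 /=.
by rewrite (_ : lift ord0 ord0 = ord_max) //; apply: val_inj.
Qed.

Lemma bivarE f : bivar f =
  \sum_(m <- msupp f) (f@_m)%:P%:P * ('X^(m ord0) * ('X%:P) ^+ (m ord_max)).
Proof. by apply: eq_bigr => m _; rewrite mmap1_bivar. Qed.

Lemma bivar_invM p q : bivar_inv (p * q) = bivar_inv p * bivar_inv q.
Proof. by rewrite /bivar_inv rmorphM /= hornerM. Qed.

Lemma bivar_inv_sum I (r : seq I) (F : I -> S) :
  bivar_inv (\sum_(i <- r) F i) = \sum_(i <- r) bivar_inv (F i).
Proof. by rewrite /bivar_inv raddf_sum /= horner_sum. Qed.

Lemma bivar_invK : cancel bivar_inv bivar.
Proof.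
move=> p; rewrite /bivar_inv /map_poly horner_poly rmorph_sum /=.
rewrite -[RHS]coefK poly_def; apply: eq_bigr => i _.
rewrite rmorphM rmorphXn /= bivarXU eqxx -mul_polyC; congr (_ * _).
rewrite horner_evalE /map_poly horner_poly rmorph_sum /=.
rewrite -[in RHS](coefK p`_i) poly_def rmorph_sum /=; apply: eq_bigr => j _.
rewrite rmorphM rmorphXn /= bivarXU bivarC /=.
by rewrite -mul_polyC polyCM rmorphXn.
Qed.

Lemma bivarK : cancel bivar bivar_inv.
Proof.
move=> f; rewrite bivarE bivar_inv_sum [RHS]mpolyE; apply: eq_bigr => m _.
rewrite !bivar_invM.
have -> : bivar_inv ('X^(m ord0)) = 'X_ord0 ^+ m ord0.
  by rewrite /bivar_inv map_polyXn hornerXn.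
have -> : bivar_inv ('X%:P ^+ m ord_max) = 'X_ord_max ^+ m ord_max.
  by rewrite /bivar_inv -rmorphXn /= map_polyC /= hornerC map_polyXn horner_evalE hornerXn.
have -> : bivar_inv (f@_m)%:P%:P = (f@_m)%:MP.
  by rewrite /bivar_inv map_polyC /= hornerC map_polyC horner_evalE hornerC.
rewrite mul_mpolyC; congr (_ *: _); rewrite [RHS]mpolyXE_id.
rewrite !big_ord_recl big_ord0 mulr1.
by rewrite (_ : lift ord0 ord0 = ord_max) //; apply: val_inj.
Qed.

Lemma evXn (a : S) k q : ev (a ^+ k) q = ev a q ^+ k.
Proof. by elim: k => [|k IH]; rewrite ?evC // !exprS evM IH. Qed.

Lemma ev_bivar f (p : 'rV[K]_2) : ev (bivar f) (p 0 ord0, p 0 ord_max) = f.@[p 0].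
Proof.
rewrite bivarE mevalE /ev !horner_sum; apply: eq_bigr => m _.
rewrite -/(ev _ (_, _)) !evM evC !evXn evX evXC; congr (_ * _).
rewrite !big_ord_recl big_ord0 mulr1 (_ : lift ord0 ord0 = ord_max) //.
exact: val_inj.
Qed.

Lemma bivar_row_poly (A : {fset 'X_{1..2}}) x0 f : msupp f =i A ->
    (forall m, m \in A -> (x0 <= m ord0)%N) ->
  bivar f = 'X^x0 * row_poly x0 (coef_row A f).
Proof.
move=> fA hA; rewrite bivarE /row_poly /support_poly mulr_sumr.
rewrite (perm_big (enum_fset A)); last first.
  by apply: uniq_perm => //; rewrite ?msupp_uniq ?fset_uniq.
rewrite [LHS]big_seq [RHS]big_seq; apply: eq_bigr => m mA.
rewrite -[coef_row A f]/(row_of A (fun m => f@_m)) row_coefE // -mul_polyC polyCM rmorphXn /=.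
rewrite -[in LHS](subnKC (hA m mA)) exprD; ring.
Qed.

End Bivariate.

(** * Counting torus roots *)

Lemma clear_denominators (F : fieldType) (x1 x2 y1 y2 u v : F) :
    x2 != 0 -> y2 != 0 ->
  x2 * y2 * (x1 / x2 * u + y1 / y2 * v) = x1 * y2 * u + y1 * x2 * v.
Proof. by move=> x20 y20; field; rewrite x20 y20. Qed.

Section Transport.
Variables (K : closedFieldType) (f g : {mpoly K[2]}).
Local Notation S := {poly {poly K}}.
Variables (f1 g1 : S) (a b : nat).
Hypotheses (fE : bivar K f = 'X^a * f1) (gE : bivar K g = 'X^b * g1).
Variable p : 'rV[K]_2.
Hypothesis pN0 : forall i, p 0 i != 0.
Local Notation J := (torus_ideal f1 g1).
Local Notation q := (p 0 ord0, p 0 ord_max).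
Local Notation L := (localize J q).

Lemma local_ringM x y : local_ring p x -> local_ring p y -> local_ring p (x * y).
Proof.
move=> [x1 [x2 [hx ->]]] [y1 [y2 [hy ->]]]; exists (x1 * y1), (x2 * y2).
by rewrite mevalM mulf_neq0 // !rmorphM /= mulf_div.
Qed.

Lemma tofrac_neq0 (x : {mpoly K[2]}) : x.@[p 0] != 0 -> tofrac x != 0.
Proof.
by move=> xp; rewrite tofrac_eq0; apply: contraNneq xp => ->; rewrite meval0.
Qed.

Lemma local_ringD x y : local_ring p x -> local_ring p y -> local_ring p (x + y).
Proof.
move=> [x1 [x2 [hx ->]]] [y1 [y2 [hy ->]]].
exists (x1 * y2 + y1 * x2), (x2 * y2); rewrite mevalM mulf_neq0 //.
by rewrite addf_div ?tofrac_neq0 // rmorphD !rmorphM.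
Qed.

Lemma local_ring_tofrac (x : {mpoly K[2]}) : local_ring p (tofrac x).
Proof. by exists x, 1; rewrite meval1 oner_eq0 rmorph1 divr1. Qed.

Lemma local_idealD x y : local_ideal f g p x -> local_ideal f g p y ->
  local_ideal f g p (x + y).
Proof.
move=> [u hu [v hv <-]] [u' hu' [v' hv' <-]].
exists (u + u'); first exact: local_ringD.
exists (v + v'); first exact: local_ringD.
by ring.
Qed.

Lemma local_idealM x y : local_ring p x -> local_ideal f g p y ->
  local_ideal f g p (x * y).
Proof.
move=> hx [u hu [v hv <-]]; exists (x * u); first exact: local_ringM.
exists (x * v); first exact: local_ringM.
by ring.
Qed.

(** At a torus point the monomials are units of the local ring, so neither the saturation nor the
    removal of monomial factors from f and g changes the local ideal. *)
Lemma local_ideal_tofrac h : local_ideal f g p (tofrac h) <-> L (bivar K h).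
Proof.
split.
  move=> [_ [x1 [x2 [hx ->]]] [_ [y1 [y2 [hy ->]]] E]].
  exists (bivar K (x2 * y2)).
    by rewrite rmorphM evM !ev_bivar mulf_neq0.
  have Eh : x2 * y2 * h = (x1 * y2) * f + (y1 * x2) * g.
    apply/eqP; rewrite -tofrac_eq; apply/eqP.
    by rewrite rmorphD !rmorphM /= -E clear_denominators ?tofrac_neq0.
  exists 0%N, 0%N, (bivar K (x1 * y2) * 'X^a), (bivar K (y1 * x2) * 'X^b).
  by rewrite scale1r mul1r -rmorphM Eh rmorphD !(rmorphM _ _ f) !(rmorphM _ _ g) fE gE; ring.
move=> [c cq [k [l [x [y E]]]]].
(* A common denominator: the powers from membership in the torus ideal, the monomial factors of f
   and g, and c. It does not vanish at q. *)
pose bt := ('X%:P ^+ k * ('X^l * ('X^a * ('X^b * c)))) : S.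
have btq : ev bt q != 0.
  by rewrite /bt !evM !evXn evX evXC !mulf_neq0 ?expf_neq0 ?pN0.
have btE : bt * bivar K h = (x * 'X^b) * bivar K f + (y * 'X^a) * bivar K g.
  rewrite fE gE; have -> : x * 'X^b * ('X^a * f1) + y * 'X^a * ('X^b * g1) =
    'X^a * 'X^b * (x * f1 + y * g1) by ring.
  by rewrite -E -mul_polyC rmorphXn /bt; ring.
pose B := bivar_inv bt; have BE : bivar K B = bt by rewrite /B bivar_invK.
have Bp : B.@[p 0] != 0 by rewrite -ev_bivar BE.
have hE : B * h = bivar_inv (x * 'X^b) * f + bivar_inv (y * 'X^a) * g.
  apply: (can_inj (@bivarK K)); rewrite rmorphD !rmorphM BE !bivar_invK.
  exact: btE.
exists (tofrac (bivar_inv (x * 'X^b)) / tofrac B); first by exists (bivar_inv (x * 'X^b)), B.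
exists (tofrac (bivar_inv (y * 'X^a)) / tofrac B); first by exists (bivar_inv (y * 'X^a)), B.
have BN0 := tofrac_neq0 Bp.
apply: (mulfI (mulf_neq0 BN0 BN0)); rewrite clear_denominators //.
have BhE : tofrac B * tofrac h = tofrac (bivar_inv (x * 'X^b)) * tofrac f +
    tofrac (bivar_inv (y * 'X^a)) * tofrac g.
  by rewrite -rmorphM hE rmorphD !rmorphM.
rewrite -[RHS]mulrA BhE mulrDr !mulrA; congr (_ * _ + _ * _); exact: mulrC.
Qed.

(** A denominator y acts injectively on S/L, hence has an inverse w modulo L. Every fraction x / y
    is thus congruent to the polynomial x w, and a basis modulo L is also one of the local ring
    modulo (f, g). *)
Lemma intersection_multiplicity_codim k N : codim J N -> codim L k ->
  intersection_multiplicity f g p k.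
Proof.
move=> cJ cL; have iJ : ideal J by exact: torus_ideal_ideal.
have iL : ideal L by exact: localize_ideal.
have sL := ideal_subspace iL; have [e he] := cL.
exists (fun i => tofrac (bivar_inv (e i))); split=> [i|_ [x [y [yp ->]]]].
  exact: local_ring_tofrac.
have [w Lw] : exists w, L (1 - bivar K y * w).
  apply: (codim_surj (phi := fun w => bivar K y * w) sL cL).
    by move=> c u v; rewrite mulrDr -scalerAr.
  move=> z; split=> [[c cq Jc]|]; last by case: iL => _ _; apply.
  exists (c * bivar K y); last by rewrite -mulrA.
  by rewrite evM mulf_neq0 // ev_bivar.
have [c [Lc cU]] := he (bivar K x * w).
pose m (c : 'rV[K]_k) := x * bivar_inv w - \sum_i (c 0 i)%:MP * bivar_inv (e i).
have mE c' : bivar K (m c') = bivar K x * w - \sum_i (c' 0 i)%:P *: e i.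
  rewrite rmorphB rmorphM bivar_invK rmorph_sum; congr (_ - _).
  by apply: eq_bigr => i _; rewrite rmorphM bivar_invK bivarC mul_polyC.
have yN0 := tofrac_neq0 yp.
have Lr : local_ideal f g p (tofrac x / tofrac y - tofrac (x * bivar_inv w)).
  have -> : tofrac x / tofrac y - tofrac (x * bivar_inv w) =
      (tofrac x / tofrac y) * tofrac (1 - y * bivar_inv w).
    rewrite rmorphB !rmorphM rmorph1 /= mulrBr mulr1; congr (_ - _).
    by rewrite mulrA divfK.
  apply: local_idealM; first by exists x, y.
  by apply/local_ideal_tofrac; rewrite rmorphB rmorph1 rmorphM bivar_invK.
have key (c' : 'rV[K]_k) : local_ideal f g p (tofrac x / tofrac y -
    \sum_(i < k) tofrac (c' 0 i)%:MP * tofrac (bivar_inv (e i))) <->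
    L (bivar K x * w - \sum_i (c' 0 i)%:P *: e i).
  have -> : bivar K x * w - \sum_i (c' 0 i)%:P *: e i = bivar K (m c').
    by rewrite (mE c').
  rewrite -local_ideal_tofrac.
  have mF : tofrac (m c') = tofrac (x * bivar_inv w) -
      \sum_(i < k) tofrac (c' 0 i)%:MP * tofrac (bivar_inv (e i)).
    rewrite /m rmorphB rmorph_sum; congr (_ - _).
    by apply: eq_bigr => i _; rewrite rmorphM.
  split=> h.
    have := local_idealD h (local_idealM (local_ring_tofrac (-1)) Lr).
    congr (local_ideal f g p _); rewrite mF rmorphN rmorph1.
    by move: (\sum_(_ < _) _) (tofrac (x * _)) => u v; ring.
  have := local_idealD Lr h; congr (local_ideal f g p _); rewrite mF.
  by move: (\sum_(_ < _) _) (tofrac (x * _)) => u v; ring.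
exists c; split=> [|c' /key]; first exact/key.
exact: cU.
Qed.

Lemma localize_torus_root : (f.@[p 0] = 0 /\ g.@[p 0] = 0) <-> ~ L 1.
Proof.
have f1p : f.@[p 0] = p 0 ord0 ^+ a * ev f1 q by rewrite -ev_bivar fE evM evXn evX.
have g1p : g.@[p 0] = p 0 ord0 ^+ b * ev g1 q by rewrite -ev_bivar gE evM evXn evX.
split=> [[fp gp] [c cq]|nL].
  rewrite mulr1 => -[k [l [x [y E]]]]; have := congr1 (fun h : S => ev h q) E.
  rewrite /= -mul_polyC rmorphXn /= !evM !evXn evX evXC evD !evM.
  have -> : ev f1 q = 0.
    by apply: (mulfI (expf_neq0 a (pN0 ord0))); rewrite -f1p mulr0.
  have -> : ev g1 q = 0.
    by apply: (mulfI (expf_neq0 b (pN0 ord0))); rewrite -g1p mulr0.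
  rewrite !mulr0 addr0 => /eqP; apply/negP.
  by rewrite !mulf_neq0 ?expf_neq0 ?pN0.
have J1 (x : S) : ev x q != 0 -> ~ J x.
  by move=> xq Jx; apply: nL; exists x; rewrite ?mulr1.
split; apply/eqP; apply: contraT => h; exfalso.
  apply: (J1 f1); first by apply: contraNneq h => e; rewrite f1p e mulr0.
  by exists 0%N, 0%N, 1, 0; rewrite scale1r mul0r addr0.
apply: (J1 g1); first by apply: contraNneq h => e; rewrite g1p e mulr0.
by exists 0%N, 0%N, 0, 1; rewrite scale1r mul0r add0r.
Qed.

End Transport.

Section RootCount.
Variable K : closedFieldType.
Local Notation S := {poly {poly K}}.

(** The product of the variables acts injectively modulo the torus ideal, so it has an inverse x
    there; the element 1 - 'X%:P * ('X * x) lies in the ideal and takes the value 1 on the axes. *)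
Lemma localize_torus_ideal_axis (f1 g1 : S) N q : codim (torus_ideal f1 g1) N ->
  q.1 * q.2 = 0 -> localize (torus_ideal f1 g1) q 1.
Proof.
move=> cJ q0; have iJ := torus_ideal_ideal f1 g1; have [J0 JD JM] := iJ.
have [x Jx] : exists x, torus_ideal f1 g1 (1 - 'X%:P * ('X * x)).
  apply: (codim_surj (phi := fun x => 'X%:P * ('X * x)) (ideal_subspace iJ) cJ).
    by move=> c u v; rewrite !mulrDr -!scalerAr.
  move=> z; split=> [h|h]; last exact: JM _ _ (JM _ _ h).
  apply: (@torus_idealM _ _ _ 1); apply: (@torus_idealZ _ _ _ 1).
  by rewrite -mul_polyC.
exists (1 - 'X%:P * ('X * x)); last by rewrite mulr1.
rewrite evB !evM evX evXC evC mulrA [q.2 * _]mulrC q0 mul0r subr0.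
exact: oner_neq0.
Qed.

Lemma sum_count_undup (T : eqType) (s : seq T) :
  (\sum_(x <- undup s) count_mem x s = size s)%N.
Proof.
rewrite -sum1_size -[RHS]big_undup_iterop_count; apply: eq_bigr => x _.
by rewrite Monoid.iteropE; elim: (count_mem x s) => //= n <-.
Qed.

(** The points of the N composition factors are the torus roots, each repeated according to its
    multiplicity. *)
Lemma torus_root_count_codim (f g : {mpoly K[2]}) (f1 g1 : S) a b N :
    bivar K f = 'X^a * f1 -> bivar K g = 'X^b * g1 ->
    codim (torus_ideal f1 g1) N ->
  torus_root_count f g N.
Proof.
move=> fE gE cJ; have iJ := torus_ideal_ideal f1 g1.
have [s sN hs] := ideal_localize_codims iJ cJ.
pose toq (p : 'rV[K]_2) := (p 0 ord0, p 0 ord_max).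
pose top (q : K * K) : 'rV[K]_2 := \row_i if i == ord0 then q.1 else q.2.
have topK : cancel top toq by move=> [x y]; rewrite /toq !mxE.
have toqK : cancel toq top.
  by move=> p; apply/rowP; apply: ord2P; rewrite !mxE.
have sE q : q \in s <-> ~ localize (torus_ideal f1 g1) q 1.
  have iL := localize_ideal q iJ; have sL := ideal_subspace iL.
  split=> [qs L1|nL].
    have c0 : count_mem q s = 0%N.
      have : codim (localize (torus_ideal f1 g1) q) 0.
        by apply/(codim_unique0 sL) => z; rewrite -[z]mulr1; case: iL => _ _; apply.
      by move=> /(codim_unique0 sL) Lz; exact: codim_full Lz (hs q).
    by move/count_memPn: c0; rewrite qs.
  apply: contraT => /count_memPn c0; case: nL.
  by have := hs q; rewrite c0 => /(codim_unique0 sL); apply.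
have torus q : q \in s -> forall i, top q 0 i != 0.
  move=> /sE nL; have : q.1 * q.2 != 0.
    by apply/eqP => q0; apply: nL; exact: localize_torus_ideal_axis cJ q0.
  by rewrite mulf_eq0 negb_or => /andP[q1 q2]; apply: ord2P; rewrite mxE.
exists [seq top q | q <- undup s], (fun p => count_mem (toq p) s); split.
- by rewrite map_inj_uniq ?undup_uniq //; exact: can_inj topK.
- move=> p; rewrite -[p]toqK (mem_map (can_inj topK)) mem_undup; split.
    move=> qs; have tp := torus _ qs.
    have := (localize_torus_root fE gE tp).2.
    rewrite !mxE /= -[(_, _)]/(toq p) => /(_ ((sE _).1 qs)) [fp gp].
    by split.
  move=> [tp fp gp]; apply/sE.
  have := (localize_torus_root fE gE tp).1 (conj fp gp).
  by rewrite !mxE.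
- move=> p; rewrite -[p]toqK (mem_map (can_inj topK)) mem_undup => qs.
  have tp := torus _ qs.
  apply: (intersection_multiplicity_codim fE gE tp cJ).
  have := hs (toq p); rewrite topK; congr (codim (localize _ _) _).
  by rewrite !mxE.
- by rewrite big_map -sN -sum_count_undup; apply: eq_bigr => q _; rewrite topK.
Qed.

End RootCount.

(** * The generic system *)

Section Genericity.
Variables (K : closedFieldType) (A B : {fset 'X_{1..2}}) (xA xB d e : nat).
Local Notation S := {poly {poly K}}.
Hypotheses (hA : forall m, m \in A -> (xA <= m ord0 <= xA + d)%N)
  (hB : forall m, m \in B -> (xB <= m ord0 <= xB + e)%N).

Let fc (c : 'rV[K]_(#|` A| + #|` B|)) : S := row_poly xA (lsubmx c).
Let gc (c : 'rV[K]_(#|` A| + #|` B|)) : S := row_poly xB (rsubmx c).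

Let hA0 m : m \in A -> (xA <= m ord0)%N.
Proof. by move=> /hA/andP[]. Qed.

Let hB0 m : m \in B -> (xB <= m ord0)%N.
Proof. by move=> /hB/andP[]. Qed.

Lemma size_generic_l c : (size (fc c) <= d.+1)%N.
Proof. by apply: size_row_poly => // m /hA/andP[]. Qed.

Lemma size_generic_r c : (size (gc c) <= e.+1)%N.
Proof. by apply: size_row_poly => // m /hB/andP[]. Qed.

Lemma polynomial_generic_l k : polynomial_family (fun c => (fc c)`_k).
Proof.
move=> h; have [mA|mA] := boolP (mnm2 (xA + k) h \in A).
  have lt : (index (mnm2 (xA + k) h) A < #|` A|)%N by rewrite index_mem.
  have [P hP] := polynomial_fun_coord K (lshift #|` B| (Ordinal lt)).
  exists P => c; rewrite coef_row_poly // mA -hP /row_coef insubT /=.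
  by rewrite mxE.
have [P hP] := polynomial_fun_cst (#|` A| + #|` B|) (0 : K).
by exists P => c; rewrite coef_row_poly // (negPf mA) -hP.
Qed.

Lemma polynomial_generic_r k : polynomial_family (fun c => (gc c)`_k).
Proof.
move=> h; have [mB|mB] := boolP (mnm2 (xB + k) h \in B).
  have lt : (index (mnm2 (xB + k) h) B < #|` B|)%N by rewrite index_mem.
  have [P hP] := polynomial_fun_coord K (rshift #|` A| (Ordinal lt)).
  exists P => c; rewrite coef_row_poly // mB -hP /row_coef insubT /=.
  by rewrite mxE.
have [P hP] := polynomial_fun_cst (#|` A| + #|` B|) (0 : K).
by exists P => c; rewrite coef_row_poly // (negPf mB) -hP.
Qed.

Lemma generic_onto (F G : S) :
    (forall k h, (F`_k)`_h != 0 -> mnm2 (xA + k) h \in A) ->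
    (forall k h, (G`_k)`_h != 0 -> mnm2 (xB + k) h \in B) ->
  exists c, fc c = F /\ gc c = G.
Proof.
move=> hF hG.
exists (row_mx (row_of A (fun m => (F`_(m ord0 - xA))`_(m ord_max)))
               (row_of B (fun m => (G`_(m ord0 - xB))`_(m ord_max)))).
by rewrite /fc /gc row_mxKl row_mxKr !row_poly_onto.
Qed.

Definition generic_det c : {poly K} := \det (sylvester (fc c) (gc c) d e).

Lemma polynomial_generic_det k : polynomial_fun (fun c => (generic_det c)`_k).
Proof.
move: k; apply: polynomial_family_det => r l k.
have [P hP] : polynomial_fun (fun c => (if (r < e)%N
    then if (l < r)%N then 0 else (fc c)`_(l - r)
    else if (l < r - e)%N then 0 else (gc c)`_(l - (r - e)))`_k).
  case: (r < e)%N; [case: (l < r)%N | case: (l < r - e)%N];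
    by [exact: (polynomial_family_cst _ 0) | exact: polynomial_generic_l
      | exact: polynomial_generic_r].
by exists P => c; rewrite -hP mxE; case: ifP => _; rewrite coefXnM.
Qed.

(* The resultant is taken with the degree of the second polynomial padded by
   one, so that the Sylvester matrix is not empty. *)
Lemma column_coprime i j :
    (exists2 m, m \in A & m ord0 = xA + i)%N ->
    (exists2 m, m \in B & m ord0 = xB + j)%N ->
  exists u, [/\ polynomial_fun u, exists c, u c != 0 &
    forall c, u c != 0 -> laurent_coprime (fc c)`_i (gc c)`_j].
Proof.
move=> [a aA ai] [b bB bj].
pose inA h := mnm2 (xA + i) h \in A; pose inB h := mnm2 (xB + j) h \in B.
have exA : exists h, inA h by exists (a ord_max); rewrite /inA -ai mnm2E.
have exB : exists h, inB h by exists (b ord_max); rewrite /inB -bj mnm2E.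
have bdA h : inA h -> (h <= \max_(m <- A) m ord_max)%N.
  move=> hh; rewrite -[X in (X <= _)%N](mnm2_max (xA + i)).
  by apply: (@leq_bigmax_seq _ (enum_fset A) xpredT
    (fun m : 'X_{1..2} => m ord_max)).
(* M1 is the top exponent of the column of A and M2 the bottom one of the column of B. With the
   columns x^M1 and x^M2, division of the second by x^M2 leaves the nonzero resultant of x^M1 and
   1. *)
case: (ex_maxnP exA bdA) => M1 M1A M1max; case: (ex_minnP exB) => M2 M2B M2min.
pose E := (\max_(m <- B) m ord_max).+1.
pose gd c := drop_poly M2 (gc c)`_j.
pose u c := \det (sylvester (fc c)`_i (gd c) M1 E).
have gdE c : (gc c)`_j = 'X^M2 * gd c.
  rewrite -[LHS](poly_take_drop M2) mulrC (_ : take_poly _ _ = 0) ?add0r //.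
  apply/polyP => h; rewrite coef_take_poly coef0; case: ltnP => // hM.
  rewrite coef_row_poly //; case: ifP => // /M2min.
  by rewrite leqNgt hM.
have szf c : (size ((fc c)`_i)%R <= M1.+1)%N.
  apply/leq_sizeP => h hM; rewrite coef_row_poly //; case: ifP => // /M1max.
  by rewrite leqNgt hM.
have szg c : (size (gd c) <= E.+1)%N.
  rewrite size_drop_poly (leq_trans (leq_subr _ _)) // (@leq_trans E) //.
  apply/leq_sizeP => h hM; rewrite coef_row_poly //; case: ifP => // hB'.
  move: hM; rewrite ltnNge; case/negP.
  rewrite -[X in (X <= _)%N](mnm2_max (xB + j)).
  by apply: (@leq_bigmax_seq _ (enum_fset B) xpredT
    (fun m : 'X_{1..2} => m ord_max)).
exists u; split.
(* [polynomial_family_det] concerns matrices over [{poly K}], so the scalar matrix is embedded by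
   [polyC] and the constant coefficient is read off. *)
- have [P hP] : polynomial_fun (fun c =>
      (\det (map_mx polyC (sylvester (fc c)`_i (gd c) M1 E)))`_0).
    apply: polynomial_family_det => r l k.
    have [P hP] : polynomial_fun (fun c => if k == 0%N then (if (r < E)%N
        then if (l < r)%N then 0 else ((fc c)`_i)`_(l - r)
        else if (l < r - E)%N then 0 else ((gc c)`_j)`_(l - (r - E) + M2)) else 0).
      case: (k == 0%N); last exact: polynomial_fun_cst.
      case: (r < E)%N; [case: (l < r)%N | case: (l < r - E)%N];
        by [exact: polynomial_fun_cst | exact: polynomial_generic_l
          | exact: polynomial_generic_r].
    exists P => c; rewrite -hP !mxE coefC; case: ifP => // _.
    by case: ifP => _; rewrite coefXnM // coef_drop_poly.
  by exists P => c; rewrite -hP det_map_mx coefC.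
- have [|k h|c [fcE gcE]] := @generic_onto (('X^M1)%:P * 'X^i) (('X^M2)%:P * 'X^j).
  + move=> k h; rewrite coefCM coefXn.
    case: (k =P i) => [->|_]; last by rewrite mulr0 coef0 eqxx.
    by rewrite mulr1 coefXn; case: (h =P M1) => [-> //|_]; rewrite eqxx.
  + rewrite coefCM coefXn.
    case: (k =P j) => [->|_]; last by rewrite mulr0 coef0 eqxx.
    by rewrite mulr1 coefXn; case: (h =P M2) => [-> //|_]; rewrite eqxx.
  exists c; rewrite /u /gd fcE gcE !coefCM !coefXn !eqxx !mulr1.
  have -> : drop_poly M2 'X^M2 = 1 :> {poly K}.
    apply/polyP => h; rewrite coef_drop_poly coefXn coef1.
    by rewrite -[X in _ == X]add0n eqn_add2r.
  exact: sylvester_Xn1.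
- move=> c uc; have [|x [y xy]] := sylvester_bezout (szf c) (szg c) _ uc.
    by rewrite addnS.
  exists ('X^M2 * x), y, M2.
  by rewrite gdE mulrCA -mulrA -mulrDr -[RHS]mulr1 -xy; congr (_ * (_ + _)); ring.
Qed.

(** * Extreme exponents of the generic determinant *)

Section Extreme.
Variables (R : realType) (sg : R) (p q : nat -> R).
Hypotheses (cp : convex_seq p d) (cq : convex_seq q e)
  (pA : forall m, m \in A -> p (m ord0 - xA)%N <= sg * (m ord_max)%:R)
  (qB : forall m, m \in B -> q (m ord0 - xB)%N <= sg * (m ord_max)%:R)
  (kp : forall i, (i <= d)%N -> corner p d i ->
    exists2 m, m \in A & m ord0 = (xA + i)%N /\ sg * (m ord_max)%:R = p i)
  (kq : forall i, (i <= e)%N -> corner q e i ->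
    exists2 m, m \in B & m ord0 = (xB + i)%N /\ sg * (m ord_max)%:R = q i).

Lemma generic_det_order c :
  order_ge sg (\sum_(k < d + e) diag_val d e p q k) (generic_det c).
Proof.
apply: det_sylvester_order => //.
- exact: size_generic_l.
- exact: size_generic_r.
- move=> i id h; rewrite coef_row_poly //; case: ifP => [mA _|]; last by rewrite eqxx.
  by have := pA mA; rewrite mnm2_0 mnm2_max addKn.
- move=> i id h; rewrite coef_row_poly //; case: ifP => [mA _|]; last by rewrite eqxx.
  by have := qB mA; rewrite mnm2_0 mnm2_max addKn.
Qed.

(** Corners of the boundary are points of the support, so the corner polynomials have their
    monomials in A and B and come from a coefficient vector c. *)
Lemma generic_det_extreme : exists a,
  \sum_(k < d + e) diag_val d e p q k = sg * a%:R /\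
  exists c, (generic_det c)`_a != 0.
Proof.
have exhp i : exists h, (i <= d)%N -> corner p d i ->
    p i = sg * h%:R /\ mnm2 (xA + i) h \in A.
  have [/andP[id ci]|] := boolP ((i <= d)%N && corner p d i); last first.
    by rewrite negb_and => n; exists 0%N => h1 h2; rewrite h1 h2 in n.
  have [m mA [m0 m1]] := kp id ci; exists (m ord_max) => _ _.
  by rewrite -m0 mnm2E m1.
have exhq i : exists h, (i <= e)%N -> corner q e i ->
    q i = sg * h%:R /\ mnm2 (xB + i) h \in B.
  have [/andP[id ci]|] := boolP ((i <= e)%N && corner q e i); last first.
    by rewrite negb_and => n; exists 0%N => h1 h2; rewrite h1 h2 in n.
  have [m mA [m0 m1]] := kq id ci; exists (m ord_max) => _ _.
  by rewrite -m0 mnm2E m1.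
have [hp hpE] := choice exhp; have [hq hqE] := choice exhq.
have [a [t [sumE Da]]] := det_corner_witness K (hp := hp) (hq := hq) cp cq
  (fun i id ci => (hpE i id ci).1) (fun j je cj => (hqE j je cj).1).
exists a; split=> //.
have [k h|k h|c [fcE gcE]] := @generic_onto (corner_poly p d hp 1) (corner_poly q e hq t).
- rewrite coef_poly ltnS; case: leqP => kd; last by rewrite coef0 eqxx.
  case: ifP => ck; last by rewrite coef0 eqxx.
  rewrite coefCM coefXn; case: (h =P hp k) => [-> _|_]; last by rewrite mulr0 eqxx.
  by have [] := hpE k kd ck.
- rewrite coef_poly ltnS; case: leqP => kd; last by rewrite coef0 eqxx.
  case: ifP => ck; last by rewrite coef0 eqxx.
  rewrite coefCM coefXn; case: (h =P hq k) => [-> _|_]; last by rewrite mulr0 eqxx.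
  by have [] := hqE k kd ck.
by exists c; rewrite /generic_det fcE gcE.
Qed.

End Extreme.
End Genericity.

Lemma fset_column_range (A : {fset 'X_{1..2}}) : A != fset0 -> exists x d,
  [/\ forall m, m \in A -> (x <= m ord0 <= x + d)%N,
     exists2 m, m \in A & m ord0 = x &
     exists2 m, m \in A & m ord0 = (x + d)%N].
Proof.
move=> /fset0Pn[m0 m0A].
have A0 : enum_fset A != [::].
  by apply/eqP => e; have : m0 \in enum_fset A := m0A; rewrite e.
have [a aA amin] := seq_min (fun m : 'X_{1..2} => (m ord0)%:R : rat) A0.
have [b bA bmax] := seq_min (fun m : 'X_{1..2} => - (m ord0)%:R : rat) A0.
have ab : (a ord0 <= b ord0)%N by rewrite -(ler_nat rat); apply: amin.
exists (a ord0), (b ord0 - a ord0)%N; rewrite subnKC //; split.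
- move=> m mA; rewrite -!(ler_nat rat) amin //=.
  by have := bmax m mA; rewrite lerN2.
- by exists a.
- by exists b.
Qed.

Theorem corollary20 (K : closedFieldType) (R : realType)
    (A B : {fset 'X_{1..2}}) (hA : A != fset0) (hB : B != fset0) :
  exists U : set 'rV[K]_(#|` A| + #|` B|),
    [/\ zariski_open U,
        U !=set0 &
        forall f g : {mpoly K[2]},
          msupp f =i A -> msupp g =i B -> U (coef_vector A B f g) ->
          exists2 N : nat,
            torus_root_count f g N &
            N%:R%:E = mixed_volume (newton_polygon R f) (newton_polygon R g)].
Proof.
have [xA [d [rA A0 Ad]]] := fset_column_range hA.
have [xB [e [rB B0 Be]]] := fset_column_range hB.
have A0' : exists2 m, m \in A & m ord0 = (xA + 0)%N by rewrite addn0.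
have B0' : exists2 m, m \in B & m ord0 = (xB + 0)%N by rewrite addn0.
have one2 : 1 * 1 = 1 :> R by rewrite mulr1.
have mone2 : -1 * -1 = 1 :> R by rewrite mulrNN mulr1.
pose H (m : 'X_{1..2}) : R := (m ord_max)%:R.
have [p [pA cp kp bp]] := hull_boundary H one2 rA A0 Ad.
have [q [qB cq kq bq]] := hull_boundary H one2 rB B0 Be.
have [p' [pA' cp' kp' bp']] := hull_boundary H mone2 rA A0 Ad.
have [q' [qB' cq' kq' bq']] := hull_boundary H mone2 rB B0 Be.
(* With sign 1 the transversal gives the least possible exponent a of x in the determinant; with
   sign -1 its sum is -b, where b is the greatest. *)
have [a [aE exa]] := generic_det_extreme K rA rB cp cq kp kq.
have [b [bE exb]] := generic_det_extreme K rA rB cp' cq' kp' kq'.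
have [u0 [pu0 exu0 hu0]] := column_coprime K rA rB A0' B0'.
have [u1 [pu1 exu1 hu1]] := column_coprime K rA rB Ad Be.
pose D c := @generic_det K A B xA xB d e c.
have pDa := polynomial_generic_det K rA rB a.
have pDb := polynomial_generic_det K rA rB b.
have pu := polynomial_funM pu0 pu1.
have pD := polynomial_funM pDa pDb.
(* P is the product of four conditions: the resultants of the first and of the last columns, and the
   coefficients of the determinant at x^a and x^b. *)
have [P PE] := polynomial_funM pu pD.
exists [set c : 'rV[K]_(#|` A| + #|` B|) | P.@[c 0] != 0]; split.
- exists [set P]; apply/seteqP; split=> c /=; first by move=> h; exists P.
  by move=> [_ -> //].
- have exu := polynomial_fun_common_nonzero pu0 pu1 exu0 exu1.
  have exD := polynomial_fun_common_nonzero pDa pDb exa exb.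
  have [c hc] := polynomial_fun_common_nonzero pu pD exu exD.
  by exists c; rewrite /= -PE.
move=> f g fA gB /=; rewrite -PE; set c := coef_vector A B f g.
rewrite !mulf_eq0 !negb_or => /andP[/andP[u0c u1c] /andP[Da Db]].
have fcE : lsubmx c = coef_row A f by rewrite row_mxKl.
have gcE : rsubmx c = coef_row B g by rewrite row_mxKr.
have rA0 m : m \in A -> (xA <= m ord0)%N by move=> /rA/andP[].
have rB0 m : m \in B -> (xB <= m ord0)%N by move=> /rB/andP[].
(* No exponent below a occurs and the one at a does, so D = x^a D' with D' nonzero at 0; as D has
   degree b, D' has degree b - a. *)
pose D' := drop_poly a (D c).
have Dlow h : (D c)`_h != 0 -> (a <= h)%N.
  move=> /(generic_det_order rA rB cp cq pA qB (c := c)).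
  by rewrite aE !mul1r ler_nat.
have Dup h : (D c)`_h != 0 -> (h <= b)%N.
  move=> /(generic_det_order rA rB cp' cq' pA' qB' (c := c)).
  by rewrite bE !mulN1r lerN2 ler_nat.
have DE : D c = 'X^a * D'.
  rewrite -[LHS](poly_take_drop a) mulrC (_ : take_poly _ _ = 0) ?add0r //.
  apply/polyP => h; rewrite coef_take_poly coef0; case: ltnP => // ha.
  by apply/eqP; apply: contraTT ha => /Dlow; rewrite -leqNgt.
have D'0 : ~~ root D' 0.
  by rewrite rootE horner_coef0 coef_drop_poly.
have szD : size (D c) = b.+1.
  apply/eqP; rewrite eqn_leq; apply/andP; split.
    apply/leq_sizeP => h hb; apply/eqP; apply: contraTT hb => /Dup.
    by rewrite -leqNgt.
  by rewrite ltnNge; apply: contra Db => /leq_sizeP/(_ b (leqnn b)) ->.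
have szD' : (size D').-1 = (b - a)%N by rewrite size_drop_poly szD; lia.
have ab : (a <= b)%N by apply: Dlow.
exists (b - a)%N.
  apply: (torus_root_count_codim (bivar_row_poly fA rA0) (bivar_row_poly gB rB0)).
  rewrite -fcE -gcE -szD'; apply: (torus_ideal_codim (d := d) (e := e)).
  - exact: size_generic_l.
  - exact: size_generic_r.
  - exact: hu1.
  - exact: hu0.
  - exact: saturation_codim DE D'0.
have polyE (X : {fset 'X_{1..2}}) (h : {mpoly K[2]}) : msupp h =i X ->
    newton_polygon R h =
    convex_hull [set ((m ord0)%:R, H m) | m in [set m | m \in enum_fset X]].
  move=> hX; congr convex_hull; apply/seteqP.
  by split=> _ [m /= mX <-]; exists m => //=; move: mX; rewrite hX.
rewrite (polyE _ _ fA) (polyE _ _ gB).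
rewrite (mixed_volume_diag (@convex_hull_convex _ _) (@convex_hull_convex _ _)
  cp cq cp' cq' bp bq bp' bq') aE bE natrB //; congr EFin; ring.
Qed.
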